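(* Let $x,y,z$ be nonnegative integers with $x\equiv z\pmod 2$, and let $\mathbf a=(a_1,\dots,a_m)$, $\mathbf b=(b_1,\dots,b_n)$, $\mathbf c=(c_1,\dots,c_k)$ be sequences of nonnegative integers with $m,n,k$ positive even integers. Put $h=\frac{x+z}{2}$, $\mu=\max(a,b)$, $\nu=\min(a,b)$. Then \begin{align*} \operatorname{M}(Q^{\odot}_{x,y,z}(\mathbf a;\mathbf c;\mathbf b))=&\operatorname{M}(C_{x,2y+z+2\mu,z}(c))\\ &\times s\left(a_1,\dots,a_{m-1},a_m+h,c_1,\dots,c_{k-1},c_k+h+b_n,b_{n-1},\dots,b_1\right)\\ &\times s\left(y+b-\nu,a_1,\dots,a_m,h+c_1,c_2,\dots,c_k,h,b_n,\dots,b_1,y+a-\nu\right)\\ &\times \frac{\operatorname{H}(c+h)}{\operatorname{H}(c)\operatorname{H}(h)}\frac{\operatorname{H}(\mu+y+h)}{\operatorname{H}(\mu+c+y+h)}\\ &\times \frac{\operatorname{H}(\mu+y+z)\operatorname{H}(\mu+c+y+z)}{\operatorname{H}(o_a+o_b+o_c+z)\operatorname{H}(|a-b|+e_a+e_b+e_c+2y+z)}\\ &\times \frac{\operatorname{H}(o_a+o_b+o_c)\operatorname{H}(|a-b|+e_a+e_b+e_c+2y)}{\operatorname{H}(\mu+y)^2}. \end{align*}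
   Context: Work on the triangular lattice drawn with horizontal lattice lines. A lozenge is the union of two unit triangles sharing an edge; a (lozenge) tiling of a region is a covering by lozenges without gaps or overlaps; $\operatorname{M}(R)$ denotes the number of tilings of $R$. Vertical distances are measured in rows (the height of a unit triangle); ''the horizontal lattice line at level $t$ above a point $P$'' is the horizontal lattice line $t$ rows above $P$. Lattice hexagons have all angles $120^\circ$ and their side-lengths are listed clockwise starting from the horizontal top side: north, northeast, southeast, south, southwest, northwest. The east vertex is the common vertex of the northeast and southeast sides; the west vertex is the common vertex of the southwest and northwest sides. Hyperfactorial: $\operatorname{H}(n)=0!\,1!\cdots(n-1)!$ for nonnegative integers $n$ ($\operatorname{H}(0)=1$). For a sequence $\mathbf t=(t_1,\dots,t_r)$ of nonnegative integers, $o_t=\sum_{i\text{ odd}}t_i$, $e_t=\sum_{i \text{ even}}t_i$, and $t=t_1+\dots+t_r$; so $a,b,c,o_a,e_a,o_b,\dots$ refer to $\mathbf a,\mathbf b,\mathbf c$. Dented semihexagon: $s(t_1,\dots,t_r)$ is the number of tilings of the region obtained from the trapezoid with horizontal top side of length $e_t$, horizontal bottom side of length $o_t+e_t$, and two slanted sides of length $o_t$, by removing from its bottom side up-pointing triangles of side-lengths $t_1,t_3,t_5,\dots$ from left to right, the first starting at the left end of the bottom side and consecutive removed triangles separated along the bottom side by distances $t_2,t_4,\dots$. (Equivalently, $s(t_1,\dots,t_{2l-1})=s(t_1,\dots,t_{2l})=\frac{1}{\operatorname{H}(t_1+t_3+\dots+t_{2l-1})}\frac{\prod_{1\le i<j\le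 2l-1,\ j-i\text{ odd}}\operatorname{H}(t_i+\dots+t_j)}{\prod_{1\le i<j\le 2l-1,\ j-i\text{ even}}\operatorname{H}(t_i+\dots+t_j)}$.) Cored hexagon: for nonnegative integers $X,Y,Z,p$, $C_{X,Y,Z}(p)$ is obtained from the hexagon $H$ with side-lengths $X,Y+p,Z,X+p,Y,Z+p$ as follows. Let $H_0$ be the hexagon with side-lengths $X,Y,Z,X,Y,Z$ whose south, southwest and northwest sides lie on the lines of the south, southwest and northwest sides of $H$; let $O$ be the center of symmetry of $H_0$. Remove the up-pointing triangle of side $p$ whose left vertex is: $O$ if $X,Y,Z$ all have the same parity; the point $1/2$ unit west of $O$ if $X$ has parity different from $Y$ and $Z$; the point $1/2$ unit from $O$ in the northwest lattice direction if $Y$ has parity different from $X$ and $Z$; the point $1/2$ unit from $O$ in the southwest lattice direction if $Z$ has parity different from $X$ and $Y$. Fern: a string of lattice triangles of side-lengths $t_1,\dots,t_r$ (side $0$ allowed) with alternating orientations, all having a horizontal side on a common horizontal lattice line $\ell$ (up-pointing ones above $\ell$, down-pointing ones below), consecutive triangles meeting at a vertex on $\ell$; it occupies a segment of $\ell$ of length $t_1+\dots+t_r$. Removing a fern means removing the union of its triangles. The region $Q^{\odot}_{x,y,z}(\mathbf a;\mathbf c;\mathbf b)$ (for $x\equiv z \pmod 2$): with $O=o_a+o_b+o_c$ and $E=e_a+e_b+e_c$, let $H$ be the hexagon with side-lengths $x+E$, $y+z+O+\max(a-b,0)$, $y+z+E+\max(b-a,0)$, $x+O$, $y+z+E+\max(a-b,0)$,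 $y+z+O+\max(b-a,0)$. Let $\ell$ be the horizontal lattice line at level $y+\max(a-b,0)$ above the east vertex of $H$ (equivalently, $z+O$ rows below the north side; it lies on or above both the west and east vertices); $\ell\cap H$ is a segment of length $x+z+a+b+c$ with endpoints on the northwest and northeast sides. Remove from $H$ three ferns along $\ell$: the left fern with side-lengths $a_1,\dots,a_m$ from left to right, $a_1$ up-pointing, starting at the left endpoint of $\ell\cap H$; the right fern with side-lengths $b_1,\dots,b_n$ read from right to left, $b_1$ up-pointing, ending at the right endpoint of $\ell\cap H$; and the middle fern with side-lengths $c_1,\dots,c_k$ from left to right, $c_1$ up-pointing, placed so that the distance along $\ell$ from the right end of the left fern to the left end of the middle fern and the distance from the right end of the middle fern to the left end of the right fern are both $\frac{x+z}{2}$. *)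

(* Defs.v *)
From HB Require Import structures.
From mathcomp Require Import all_boot all_order all_algebra.
From mathcomp Require Import finmap.

Set Implicit Arguments.
Unset Strict Implicit.
Unset Printing Implicit Defensive.

Local Open Scope nat_scope.

(* The lattice point (i, j) is i * e + j * f, where e is the unit vector
   pointing east and f the unit vector at 60 degrees from e (northeast).
   Horizontal lattice lines are j = const; the lines of slope +60 degrees are
   i = const and those of slope -60 degrees are i + j = const.
   Every region below is translated so that it lies in i, j >= 0. *)
Definition point : Type := (nat * nat)%type.

(* (true, (i, j)) is the up-pointing unit triangle with left vertex (i, j);
   (false, (i, j)) is the down-pointing unit triangle that completes it to a
   parallelogram. *)
Definition utri : Type := (bool * point)%type.

Definition vertices (t : utri) : seq point :=
  let: (up, (i, j)) := t in
  [:: (if up then (i, j) else (i.+1, j.+1)); (i.+1, j); (i, j.+1)].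

(* Sharing an edge = having exactly two common vertices. *)
Definition adjacent (t u : utri) : bool :=
  count (fun v => v \in vertices u) (vertices t) == 2.

Definition inside (P : pred point) (t : utri) : bool := all P (vertices t).

Definition region : Type := {fset utri}.

Definition is_lozenge (R : region) (L : {set R}) : bool :=
  [exists t : R, exists u : R,
     adjacent (val t) (val u) && (L == [set t; u])].

Definition is_tiling (R : region) (T : {set {set R}}) : bool :=
  partition T [set: R] && [forall L in T, is_lozenge L].

Definition M (R : region) : nat := #|[set T : {set {set R}} | is_tiling T]|.

(* Lattice triangles of side s with left end of the horizontal side at (p, q). *)
Definition up_triangle (p q s : nat) : pred point :=
  fun v => [&& p <= v.1, q <= v.2 & v.1 + v.2 <= p + q + s].

Definition down_triangle (p q s : nat) : pred point :=
  fun v => [&& v.1 <= p + s, v.2 <= q & p + q <= v.1 + v.2].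

(* The lattice hexagon with the given side-lengths, for N + NE = S + SW and
   NE + SE = SW + NW (the sides close up). Its vertices are
   (SW, 0), (SW + S, 0), (SW + S, SE), (N, SW + NW), (0, SW + NW), (0, SW),
   counterclockwise from the left end of the south side; (SW + S, SE) is the
   east vertex and (0, SW) the west vertex. *)
Definition hexagon_pt (N NE SE S SW NW : nat) : pred point :=
  fun v => [&& v.1 <= N + NE, v.2 <= SW + NW & SW <= v.1 + v.2 <= SW + S + SE].

Definition hexagon (N NE SE S SW NW : nat) : region :=
  [fset t in [seq (up, v) | up <- [:: true; false],
                            v <- [seq (i, j) | i <- iota 0 (N + NE),
                                               j <- iota 0 (SW + NW)]]
     | inside (hexagon_pt N NE SE S SW NW) t]%fset.

Definition remove (R : region) (D : pred utri) : region :=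
  [fset t in R | ~~ D t]%fset.

(* Sequences are indexed from 0, so t_1, t_3, ... sit at even positions. *)
Definition osum (t : seq nat) : nat := \sum_(i < size t | ~~ odd i) nth 0 t i.
Definition esum (t : seq nat) : nat := \sum_(i < size t | odd i) nth 0 t i.

Definition hyperfactorial (n : nat) : nat := \prod_(i < n) i`!.

Definition dents (t : seq nat) : pred utri :=
  fun u => [exists i : 'I_(size t),
    ~~ odd i && inside (up_triangle (sumn (take i t)) 0 (nth 0 t i)) u].

(* The trapezoid is the hexagon whose southeast and southwest sides are 0. *)
Definition dented_semihexagon (t : seq nat) : region :=
  remove (hexagon (esum t) (osum t) 0 (osum t + esum t) 0 (osum t)) (dents t).

Definition s (t : seq nat) : nat := M (dented_semihexagon t).

(* H_0 shares the vertices (Y, 0) and (0, Y) with H, and its centre is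
   ((X + Y) / 2, (Y + Z) / 2). The pairs below are twice the coordinates of the
   left vertex of the core, the shifts being half of the vectors (-1, 0) (west),
   (-1, 1) (northwest) and (0, -1) (southwest); both entries are even, and the
   truncated predecessors are applied to odd numbers only. *)
Definition core_vertex (X Y Z : nat) : point :=
  let: (i2, j2) :=
    if (odd X == odd Y) && (odd Y == odd Z) then (X + Y, Y + Z)
    else if odd Y == odd Z then ((X + Y).-1, Y + Z)
    else if odd X == odd Z then ((X + Y).-1, (Y + Z).+1)
    else (X + Y, (Y + Z).-1) in
  (i2./2, j2./2).

Definition cored_hexagon (X Y Z p : nat) : region :=
  let: (i, j) := core_vertex X Y Z in
  remove (hexagon X (Y + p) Z (X + p) Y (Z + p)) (inside (up_triangle i j p)).

(* The fern with sides t from left to right, starting at (p, q); its leftmost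
   triangle points up iff up is true. *)
Definition fern (up : bool) (p q : nat) (t : seq nat) : pred utri :=
  fun u => [exists i : 'I_(size t),
    let p_i := p + sumn (take i t) in
    inside (if up (+) odd i then up_triangle p_i q (nth 0 t i)
            else down_triangle p_i q (nth 0 t i)) u].

(* Truncated subtraction: a - b is max(a - b, 0) and b - a is max(b - a, 0).
   The line l is at height lev, its intersection with the hexagon starts at
   (0, lev). The right fern is listed from left to right: since b_1, its
   rightmost triangle, points up, the leftmost one points up iff the number of
   triangles is odd. *)
Definition Qregion (x y z : nat) (sa sc sb : seq nat) : region :=
  let a := sumn sa in
  let b := sumn sb in
  let c := sumn sc in
  let O := osum sa + osum sb + osum sc in
  let E := esum sa + esum sb + esum sc in
  let SE := y + z + E + (b - a) in
  let lev := SE + (y + (a - b)) in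
  let h := (x + z)./2 in
  remove (hexagon (x + E) (y + z + O + (a - b)) SE
                  (x + O) (y + z + E + (a - b)) (y + z + O + (b - a)))
    (fun u => [|| fern true 0 lev sa u,
                  fern true (a + h) lev sc u
                | fern (odd (size sb)) (a + h + c + h) lev (rev sb) u]).

(* Main.v *)
(** Cut the region along [l]. The lozenges crossing [l] occupy a set [S] of [z]
   positions of the two gaps, and the two halves, completed by forced lozenges
   to trapezoids, are dented at the fern triangles they contain and at [S]. A
   trapezoid of height [n] with dents at [p_1 < ... < p_n] has
   [prod_(i < j) (p_j - p_i) / H(n)] tilings, so the summand splits as
   [Delta(U) Delta(D) * Delta(S)^2 prod_(s in S, w in U + D) |s - w|], where [U]
   and [D] are the dents of the upper and lower half coming from the ferns and
   the boundary. Only the union of [U] and [D] enters the sum over [S]: it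
   consists of two intervals of length [y + mu] and one of length [c],
   separated by the two gaps. Cutting the cored hexagon
   [C_{x, 2y+z+2mu, z}(c)] along the base of its core produces the same sum, and
   the factors [Delta(U)] and [Delta(D)] are the two dented semihexagons. *)

Require Import Defs.
From mathcomp Require Import all_boot all_order all_algebra.
From mathcomp Require Import finmap zify ring.
Import GRing.Theory Num.Theory.

Set Implicit Arguments.
Unset Strict Implicit.
Unset Printing Implicit Defensive.

Local Open Scope nat_scope.

(** * Perfect matchings and tilings *)

(** The size of [S] is never imposed: the cut sums over all sets of crossing positions, and a
    trapezoid whose number of dents differs from its height has no tilings, so only size [z]
    survives. The product formula for a trapezoid comes from a determinant of binomial coefficients,
    built row by row: the vertical lozenges leaving the bottom row interlace with its dents, and
    sums of binomial rows over an interval telescope. In [Q] the line [l] lies [y + max(b - a, 0)]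
    rows above the west vertex and [y + max(a - b, 0)] rows above the east one. Adding the fern
    lengths [a] and [b] gives [n = y + mu] on both sides, which explains the side [2y + z + 2mu] of
    the cored hexagon. For that hexagon the dents are intervals, and their Vandermonde products give
    the quotients [H(c+h)/(H(c)H(h))], [H(mu+y+h)/H(mu+c+y+h)] and [1/H(mu+y)^2]. The other
    hyperfactorials are the denominators of the four trapezoids and of the two dented
    semihexagons. *)

Definition domino (T : finType) (adj : rel T) (L : {set T}) : bool :=
  [exists t : T, exists u : T, adj t u && (L == [set t; u])].

(** Copies the shape of [is_tiling] for an arbitrary relation on a finite type, so that [M_nmatch]
    holds by conversion. *)
Definition perfect_matching (T : finType) (adj : rel T) (A : {set T})
    (P : {set {set T}}) : bool :=
  partition P A && [forall L in P, domino adj L].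

Definition nmatch (T : finType) (adj : rel T) (A : {set T}) : nat :=
  #|[set P : {set {set T}} | perfect_matching adj A P]|.

Section Matchings.
Variables (T : finType) (adj : rel T).
Hypotheses (adjC : symmetric adj) (adjxx : irreflexive adj).
Implicit Types (A L : {set T}) (P Q : {set {set T}}).

Lemma nmatch0 : nmatch adj set0 = 1.
Proof.
rewrite /nmatch (_ : [set P | _] = [set set0]) ?cards1 //.
apply/setP=> P; rewrite !inE /perfect_matching partition_set0.
case: eqP => // ->; apply/forall_inP => L; by rewrite inE.
Qed.

Lemma set2_inj (t u v : T) : [set t; u] = [set t; v] -> adj t u -> u = v.
Proof.
move=> /setP e tu; have := e u; rewrite !inE eqxx orbT => /esym/orP[] /eqP // ut.
by move: tu; rewrite ut adjxx.
Qed.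

Lemma card_matching_with A t u : t \in A -> u \in A -> adj t u ->
  #|[set P | perfect_matching adj A P && ([set t; u] \in P)]|
  = nmatch adj (A :\: [set t; u]).
Proof.
move=> tA uA tu; set L := [set t; u].
have LA : L \subset A by apply/subsetP=> v; rewrite !inE => /orP[]/eqP->.
have L0 : L != set0 by apply/set0Pn; exists t; rewrite !inE eqxx.
have Ld : domino adj L.
  by apply/existsP; exists t; apply/existsP; exists u; rewrite tu eqxx.
rewrite /nmatch -(card_in_imset (f := fun P => P :\ L)); last first.
  move=> P Q; rewrite !inE => /andP[_ LP] /andP[_ LQ] e.
  by rewrite -(setD1K LP) e setD1K.
congr #|pred_of_set _|; apply/setP=> Q; rewrite inE; apply/imsetP/idP.
  move=> [P]; rewrite inE => /andP[/andP[pP dP] LP] ->.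
  apply/andP; split; first exact: partitionD1.
  by apply/forall_inP=> K; rewrite !inE => /andP[_] /(forall_inP dP).
move=> /andP[pQ dQ].
have dis : [disjoint L & A :\: L] by rewrite -setI_eq0 setIDA setDIl setDv set0I.
have LQ : L \notin Q.
  apply/negP=> LQ; have := partitionS pQ LQ; rewrite subsetD => /andP[_].
  by rewrite -setI_eq0 setIid (negbTE L0).
exists (L |: Q); last by rewrite setU1K.
rewrite !inE eqxx andbT; apply/andP; split.
  by rewrite -{1}(setID A L) (setIidPr LA); apply: partitionU1.
by apply/forall_inP=> K; rewrite !inE => /predU1P[->//|/(forall_inP dQ)].
Qed.

(** Double counting of the pairs of a matching and a partner of [t]: the block containing [t]
    determines exactly one partner. *)
Lemma nmatch_rec A t : t \in A ->
  nmatch adj A = \sum_(u in A | adj t u) nmatch adj (A :\: [set t; u]).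
Proof.
move=> tA; transitivity (\sum_(u in A | adj t u)
  \sum_(P | perfect_matching adj A P && ([set t; u] \in P)) 1).
  rewrite (exchange_big_dep (perfect_matching adj A)) /=; last first.
    by move=> u P _ /andP[].
  rewrite /nmatch cardsE -sum1_card; apply: eq_bigr => P inP.
  have pmP : perfect_matching adj A P := inP.
  have /andP[pP dP] := pmP.
  have tcP : t \in cover P by rewrite (cover_partition pP).
  have bP := pblock_mem tcP.
  have := forall_inP dP _ bP => /existsP[x /existsP[y /andP[xy /eqP def]]].
  have tb : t \in pblock P t by rewrite mem_pblock.
  have [u tu defb] : exists2 u, adj t u & pblock P t = [set t; u].
    move: tb; rewrite def !inE => /orP[]/eqP e; subst.
      by exists y.
    by exists x; [rewrite adjC | rewrite setUC].
  rewrite (bigD1 u) /=; last first.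
    rewrite pmP -defb bP tu !andbT.
    apply: (subsetP (partitionS pP bP)); by rewrite defb !inE eqxx orbT.
  rewrite big1 // => v /andP[/andP[/andP[_ tv] /andP[_ vP]] /eqP[]].
  apply: set2_inj tv; rewrite -defb; apply/esym/def_pblock => //.
    exact: partition_trivIset pP.
  by rewrite !inE eqxx.
apply: eq_bigr => u /andP[uA tu]; rewrite -card_matching_with //.
by rewrite -sum1_card; apply: eq_bigl => P; rewrite inE.
Qed.
End Matchings.

(** Induction on the size of [A] through [nmatch_rec], so that no partition has to be transported
    along [f]. *)
Lemma nmatch_relabel (T T' : finType) (adj : rel T) (adj' : rel T')
    (f : T -> T') (A : {set T}) :
  symmetric adj -> irreflexive adj -> symmetric adj' -> irreflexive adj' ->
  {in A &, injective f} ->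
  {in A &, forall t u, adj' (f t) (f u) = adj t u} ->
  nmatch adj' (f @: A) = nmatch adj A.
Proof.
move=> aC ax aC' ax'; have [k] := ubnP #|A|.
elim: k A => // k IHk A ltk fI fA.
have [->|[t tA]] := set_0Vmem A; first by rewrite imset0 !nmatch0.
rewrite (nmatch_rec aC ax tA) (nmatch_rec aC' ax' (imset_f f tA)).
rewrite [LHS](eq_bigl (fun u' => (u' \in f @: [set u in A | adj t u]))); last first.
  move=> u'; apply/andP/imsetP => [[/imsetP[u uA ->]]|[u]].
    by rewrite fA // => tu; exists u; rewrite ?inE ?uA.
  by rewrite inE => /andP[uA tu] ->; rewrite fA // imset_f.
rewrite big_imset /=; last first.
  by move=> u v; rewrite !inE => /andP[uA _] /andP[vA _]; apply: fI.
rewrite (eq_bigl (fun u => (u \in A) && adj t u)); last by move=> u; rewrite inE.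
apply: eq_bigr => u /andP[uA tu].
have -> : f @: A :\: [set f t; f u] = f @: (A :\: [set t; u]).
  apply/setP=> w; rewrite !inE; apply/andP/imsetP.
    move=> [nw /imsetP[v vA e]]; exists v => //; rewrite !inE vA andbT; subst w.
    by apply: contra nw => /orP[]/eqP->; rewrite eqxx ?orbT.
  move=> [v]; rewrite !inE => /andP[nv vA] ->; rewrite imset_f //; split=> //.
  apply: contra nv => /orP[]/eqP/fI -> //; by rewrite eqxx ?orbT.
have sub : {subset A :\: [set t; u] <= A} by move=> v /setDP[].
apply: IHk; last 2 [by move=> v w /sub ? /sub ?; apply: fI].
  rewrite -ltnS; apply: leq_trans ltk; rewrite ltnS; apply: proper_card.
  by apply/properP; split; [apply/subsetP | exists t; rewrite ?inE ?eqxx].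
by move=> v w /sub ? /sub ?; apply: fA.
Qed.

(** * Adjacency in the lattice, recursions for [M], and cutting a region in two *)

Definition adj_updown (i j i' j' : nat) : bool :=
  [|| (i' == i) && (j' == j), (i'.+1 == i) && (j' == j)
    | (i' == i) && (j'.+1 == j)].

Lemma adjacentE (b b' : bool) (i j i' j' : nat) :
  adjacent (b, (i, j)) (b', (i', j')) =
  if b then ~~ b' && adj_updown i j i' j' else b' && adj_updown i' j' i j.
Proof.
(* Only the differences -1, 0 and 1 of coordinates are ever tested; naming these tests by exclusive
   booleans leaves a finite check. *)
have cmp (k l : nat) : exists e1 e2 e3 : bool,
    [/\ (k == l) = e1, (l == k) = e1, (k == l.+1) = e2, (l.+1 == k) = e2
      & (k.+1 == l) = e3] /\
    [/\ (l == k.+1) = e3, ~~ (e1 && e2), ~~ (e1 && e3) & ~~ (e2 && e3)].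
  by exists (k == l), (k == l.+1), (k.+1 == l); split; split; lia.
have [e1 [e2 [e3 [[E1 E2 E3 E4 E5] [E6 n1 n2 n3]]]]] := cmp i i'.
have [f1 [f2 [f3 [[F1 F2 F3 F4 F5] [F6 m1 m2 m3]]]]] := cmp j j'.
rewrite /adjacent /adj_updown.
case: b; case: b'; rewrite /= !inE !xpair_eqE /= ?eqSS;
  rewrite ?(E1, E2, E3, E4, E5, E6) ?(F1, F2, F3, F4, F5, F6);
  clear -n1 n2 n3 m1 m2 m3;
  by move: n1 n2 n3 m1 m2 m3; case: e1 e2 e3 f1 f2 f3 => [] [] [] [] [] [].
Qed.

Lemma adjacentC : symmetric adjacent.
Proof. by move=> [b [i j]] [b' [i' j']]; rewrite !adjacentE; case: b; case: b'. Qed.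

Lemma adjacentxx : irreflexive adjacent.
Proof. by move=> [b [i j]]; rewrite adjacentE; case: b. Qed.

Lemma M_nmatch (R : region) :
  M R = nmatch (fun t u : R => adjacent (val t) (val u)) [set: R].
Proof. by []. Qed.

Lemma M_fset0 : M fset0 = 1.
Proof.
rewrite M_nmatch (_ : [set: _] = set0) ?nmatch0 //.
by apply/setP=> -[x xin]; exfalso; rewrite inE in xin.
Qed.

Local Open Scope fset_scope.
Local Open Scope nat_scope.

(** Everything is asked on [R] only, because the half-turn used later is written with truncated
    subtraction and is meaningless elsewhere. *)
Lemma M_imfset (R R' : region) (f : utri -> utri) :
  (forall t, t \in R -> f t \in R') ->
  (forall t', t' \in R' -> exists2 t, t \in R & t' = f t) ->
  {in R &, injective f} ->
  {in R &, forall t u, adjacent (f t) (f u) = adjacent t u} ->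
  M R' = M R.
Proof.
move=> fR fR' fI fA; rewrite !M_nmatch.
pose g (t : R) : R' := [` fR (val t) (valP t)].
have -> : [set: R'] = g @: [set: R].
  apply/setP=> t'; rewrite inE; apply/esym/imsetP.
  have [t tR e] := fR' _ (valP t'); exists [` tR] => //; exact: val_inj.
apply: nmatch_relabel.
- by move=> t u; rewrite adjacentC.
- by move=> t; rewrite adjacentxx.
- by move=> t u; rewrite adjacentC.
- by move=> t; rewrite adjacentxx.
- move=> t u _ _ /(congr1 val) /= e; apply: val_inj.
  by apply: fI e; apply: fsvalP.
- by move=> t u _ _; rewrite /= fA ?fsvalP.
Qed.

(** [R] and [R] without a lozenge are different finite types; the inclusion [g] settles this once,
    and afterwards regions are plain sets of triangles. *)
Lemma M_rec (R : region) t : t \in R ->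
  M R = \sum_(u <- R | adjacent t u) M (R `\ t `\ u).
Proof.
move=> tR; rewrite M_nmatch (@nmatch_rec _ _ _ _ _ [` tR]) //; last first.
- by move=> u; rewrite adjacentxx.
- by move=> u v; rewrite adjacentC.
rewrite [RHS]big_seq_fsetE /=; apply: eq_big => [u|u _]; first by rewrite inE.
set R' := R `\ t `\ val u; rewrite M_nmatch.
have sub v : v \in R' -> v \in R by rewrite !inE => /and3P[].
pose g (v : R') : R := [` sub (val v) (valP v)].
have -> : [set: R] :\: [set [` tR]; u] = g @: [set: R'].
  apply/setP=> v; rewrite !inE andbT; apply/idP/imsetP.
    rewrite negb_or => /andP[vt vu]; have vR' : val v \in R'.
      by rewrite !inE fsvalP andbT; apply/andP; split.
    by exists [` vR'] => //; apply: val_inj.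
  move=> [w _ ->]; have := fsvalP w; rewrite !inE negb_or => /and3P[wu wt _].
  by rewrite -!val_eqE /= wt wu.
apply: nmatch_relabel => //.
- by move=> v w; rewrite adjacentC.
- by move=> v; rewrite adjacentxx.
- by move=> v w; rewrite adjacentC.
- by move=> v; rewrite adjacentxx.
- by move=> v w _ _ /(congr1 val) /= e; apply: val_inj.
Qed.

Lemma M_rec_seq (R : region) t (nb : seq utri) : t \in R -> uniq nb ->
  (forall u, u \in R -> adjacent t u -> u \in nb) ->
  M R = \sum_(u <- nb | (u \in R) && adjacent t u) M (R `\ t `\ u).
Proof.
move=> tR nbU nbR; rewrite (M_rec tR) -big_filter -[RHS]big_filter.
apply: perm_big; apply: uniq_perm; rewrite ?filter_uniq ?fset_uniq // => u.
rewrite !mem_filter /=; case: (boolP (u \in R)) => uR; last by rewrite andbF.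
by rewrite andbT; case: (boolP (adjacent t u)) => //= /(nbR _ uR) ->.
Qed.

Lemma M_forced (R : region) t u : t \in R -> u \in R -> adjacent t u ->
  (forall v, v \in R -> adjacent t v -> v = u) -> M R = M (R `\ t `\ u).
Proof.
move=> tR uR tu Ru; rewrite (@M_rec_seq R t [:: u]) //.
  by rewrite big_cons big_nil uR tu addn0.
by move=> v vR tv; rewrite inE (Ru v).
Qed.

Lemma M_isolated (R : region) t : t \in R ->
  (forall v, v \in R -> ~~ adjacent t v) -> M R = 0.
Proof.
move=> tR Rt; rewrite (@M_rec_seq R t [::]) ?big_nil // => v vR tv.
by move: (Rt _ vR); rewrite tv.
Qed.

(** [V] records the lozenges across the cut. By injectivity a triangle [t] of [R1] has at most one
    partner in [R2]. The induction removes triangles of [R1]: the sets [V] using [t] correspond to a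
    partner across the cut, the others to a partner in [R1]. *)
Lemma M_cut (N : nat) (up_ dn_ : 'I_N -> utri) (R1 R2 : region) :
  injective up_ -> injective dn_ -> [disjoint R1 & R2]%fset ->
  (forall t u, t \in R1 -> u \in R2 ->
     adjacent t u = [exists k, (t == up_ k) && (u == dn_ k)]) ->
  M (R1 `|` R2) =
  \sum_(V : {set 'I_N} | [forall k in V, (up_ k \in R1) && (dn_ k \in R2)])
     M (R1 `\` [fset up_ k | k in V]) * M (R2 `\` [fset dn_ k | k in V]).
Proof.
move=> upI dnI; have [m] := ubnP #|` R1|.
elim: m R1 R2 => // m IHm R1 R2 ltm dis crossE.
have memu (V : {set 'I_N}) k : (up_ k \in [fset up_ l | l in V]) = (k \in V).
  apply/imfsetP/idP => [[l /= lV /upI -> //]|kV]; by exists k.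
have memd (V : {set 'I_N}) k : (dn_ k \in [fset dn_ l | l in V]) = (k \in V).
  apply/imfsetP/idP => [[l /= lV /dnI -> //]|kV]; by exists k.
have [R10|[t tR1]] := fset_0Vmem R1.
  rewrite (big_pred1 set0).
    by rewrite R10 fset0U fset0D M_fset0 mul1n (_ : [fset _ | k in set0] = fset0)
      ?fsetD0 //; apply/fsetP=> u; rewrite !inE; apply/imfsetP=> -[k]; rewrite /= inE.
  move=> V /=; apply/forall_inP/eqP => [h|->].
    by apply/setP=> k; rewrite inE; apply/negP=> /h; rewrite R10 inE.
  by move=> k; rewrite inE.
have disP u : u \in R1 -> u \in R2 -> False.
  by move=> u1 u2; have := fdisjointP dis _ u1; rewrite u2.
have lt1 (X : {fset utri}) : X `<=` R1 -> t \notin X -> #|` X| < m.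
  move=> XR tX; rewrite -ltnS; apply: leq_trans ltm; rewrite ltnS.
  apply: fproper_ltn_card; rewrite fproperEneq XR andbT.
  by apply: contraNneq tX => ->.
rewrite (@M_rec_seq _ t (enum_fset R1 ++ enum_fset R2)); last 3 first.
- by rewrite inE tR1.
- rewrite cat_uniq !fset_uniq andbT /=; apply/hasPn=> u /= u2; apply/negP=> u1.
  exact: disP u1 u2.
- by move=> u; rewrite mem_cat inE.
rewrite big_cat /= (bigID (fun V : {set 'I_N} => [exists k in V, t == up_ k])) /= addnC.
congr (_ + _).
(* Partner across the cut: both sides vanish unless [t] is some [up_ k0] with [dn_ k0] in [R2]. *)
- case: (pickP (fun k => t == up_ k)) => [k0 /eqP tk|no]; last first.
    rewrite big_seq_cond big1 ?big1 //.
      by move=> V /andP[_ /existsP[k /andP[_]]]; rewrite no.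
    move=> u /and3P[u2 _]; rewrite crossE // => /existsP[k /andP[]]; by rewrite no.
  have [d2|nd2] := boolP (dn_ k0 \in R2); last first.
    rewrite big_seq_cond big1 ?big1 //.
      move=> V /andP[/forall_inP h /exists_inP[k kV /eqP]]; rewrite tk => /upI ek.
      by move: (h k kV); rewrite -ek (negbTE nd2) andbF.
    move=> u /and3P[u2 _]; rewrite crossE // tk => /existsP[k /andP[/eqP/upI <-]].
    by move=> /eqP eu; rewrite eu (negbTE nd2) in u2.
  have -> : \sum_(u <- R2 | (u \in R1 `|` R2) && adjacent t u)
     M ((R1 `|` R2) `\ t `\ u) = M ((R1 `|` R2) `\ t `\ dn_ k0).
    rewrite -big_filter (_ : [seq _ <- _ | _] = [:: dn_ k0]) ?big_seq1 //.
    apply: perm_small_eq => //; apply: uniq_perm; rewrite ?filter_uniq ?fset_uniq //.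
    move=> u; rewrite mem_filter !inE; apply/idP/eqP => [/andP[/andP[_ tu] u2]|->].
      move: tu; rewrite crossE // => /existsP[k /andP[/eqP]].
      by rewrite tk => /upI <- /eqP.
    rewrite d2 orbT /= andbT crossE //; apply/existsP; exists k0.
    by rewrite tk !eqxx.
  have -> : (R1 `|` R2) `\ t `\ dn_ k0 = (R1 `\ t) `|` (R2 `\ dn_ k0).
    apply/fsetP=> u; rewrite !inE.
    case: (boolP (u \in R1)) => u1; case: (boolP (u \in R2)) => u2 /=.
    + by case: (disP u).
    + have -> : u != dn_ k0 by apply: contraNneq u2 => ->.
      by rewrite ?andbF ?orbF ?andbT.
    + have -> : u != t by apply: contraNneq u1 => ->.
      by rewrite ?andbF ?orbF ?andbT.
    + by rewrite !andbF.
  rewrite IHm; last 3 first.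
  + apply: lt1; last by rewrite !inE eqxx.
    by apply/fsubsetP=> u; rewrite !inE => /andP[].
  + apply/fdisjointP=> u; rewrite !inE => /andP[_ u1]; apply/negP=> /andP[_ u2].
    exact: disP u1 u2.
  + by move=> u v; rewrite !inE => /andP[_ u1] /andP[_ v2]; apply: crossE.
  rewrite [RHS](reindex_onto (fun V => k0 |: V) (fun V => V :\ k0)) /=; last first.
    move=> V /andP[_ /exists_inP[k kV /eqP]]; rewrite tk => /upI e.
    by rewrite setD1K // e.
  apply: eq_big => [V|V /forall_inP h].
    have [kV|nkV] := boolP (k0 \in V).
      have -> : (k0 |: V) :\ k0 == V = false.
        by apply/negP=> /eqP/setP/(_ k0); rewrite !inE eqxx kV.
      rewrite andbF; apply/negP=> /forall_inP/(_ _ kV); by rewrite tk !inE eqxx.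
    rewrite setU1K // eqxx andbT.
    have -> : [exists k in k0 |: V, t == up_ k].
      by apply/exists_inP; exists k0; rewrite ?tk ?inE eqxx.
    rewrite andbT; apply/forall_inP/forall_inP => h k.
      rewrite !inE => /predU1P[->|/h]; first by rewrite -tk tR1.
      by rewrite !inE => /andP[/andP[_ ->] /andP[_ ->]].
    move=> kV; have kk : k != k0 by apply: contraNneq nkV => <-.
    have := h k; rewrite !inE kV orbT => /(_ isT) /andP[-> ->].
    by rewrite tk (inj_eq upI) (inj_eq dnI) kk.
  congr (M _ * M _); apply/fsetP=> u; rewrite !inE.
    have -> : (u \in [fset up_ k | k in k0 |: V]) =
              (u == t) || (u \in [fset up_ k | k in V]).
      apply/imfsetP/predU1P => [[k /= kV ->]|[->|/imfsetP[k /= kV ->]]].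
      * move: kV; rewrite !inE => /predU1P[->|kV]; [by left; rewrite tk|right].
        by rewrite memu.
      * by exists k0; rewrite ?inE ?eqxx.
      * by exists k; rewrite ?inE ?kV ?orbT.
    by rewrite negb_or andbA [in LHS](andbC (u \notin _)) -!andbA andbCA andbA.
  have -> : (u \in [fset dn_ k | k in k0 |: V]) =
            (u == dn_ k0) || (u \in [fset dn_ k | k in V]).
    apply/imfsetP/predU1P => [[k /= kV ->]|[->|/imfsetP[k /= kV ->]]].
    * move: kV; rewrite !inE => /predU1P[->|kV]; [by left|right].
      by rewrite memd.
    * by exists k0; rewrite ?inE ?eqxx.
    * by exists k; rewrite ?inE ?kV ?orbT.
  by rewrite negb_or -andbA andbCA.
(* Partner in [R1]: after the induction hypothesis for each [u] the sums are exchanged, and the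
   recursion at [t] is folded back for each fixed [V]. *)
- transitivity (\sum_(u <- R1 | adjacent t u) M (((R1 `\ t) `\ u) `|` R2)).
    rewrite big_seq_cond [RHS]big_seq_cond; apply: eq_big => u.
      by rewrite !inE; case: (boolP (u \in R1)).
    move=> /andP[u1 _]; congr M; apply/fsetP=> v; rewrite !inE.
    have [v2|] := boolP (v \in R2); last by rewrite !orbF.
    rewrite !orbT !andbT; apply/andP; split; apply/negP=> /eqP e; subst v.
      exact: disP u1 v2.
    exact: disP tR1 v2.
  transitivity (\sum_(V : {set 'I_N} | [forall k in V, (up_ k \in R1) && (dn_ k \in R2)]
       && ~~ [exists k in V, t == up_ k])
     \sum_(u <- R1 | (u \in R1 `\` [fset up_ k | k in V]) && adjacent t u)
       M ((R1 `\` [fset up_ k | k in V]) `\ t `\ u) * M (R2 `\` [fset dn_ k | k in V])).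
    rewrite (exchange_big_dep (fun u => adjacent t u)) /=; last first.
      by move=> V u _ /andP[].
    rewrite big_seq_cond [RHS]big_seq_cond.
    apply: eq_bigr => u /andP[u1 tu].
    rewrite IHm; last 3 first.
    + apply: lt1; last by rewrite !inE eqxx andbF.
      by apply/fsubsetP=> v; rewrite !inE => /and3P[].
    + apply/fdisjointP=> v; rewrite !inE => /and3P[_ _ v1]; apply/negP=> v2.
      exact: disP v1 v2.
    + by move=> v w; rewrite !inE => /and3P[_ _ v1]; apply: crossE.
    apply: eq_big => [V|V _].
      rewrite !inE u1 tu !andbT; apply/forall_inP/andP => [h|[/andP[/forall_inP h nt] nu] k kV].
        split; first (apply/andP; split).
        * by apply/forall_inP=> k /h; rewrite !inE => /andP[/and3P[_ _ ->]].
        * apply/negP=> /exists_inP[k kV /eqP e]; have := h k kV.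
          by rewrite !inE e eqxx andbF.
        * apply/negP=> /imfsetP[k /= kV e]; have := h k kV.
          by rewrite !inE e eqxx.
      have /andP[k1 ->] := h k kV; rewrite !inE k1 !andbT; apply/andP; split.
        by apply: contraNneq nu => <-; rewrite memu.
      by apply: contraNneq nt => e; apply/exists_inP; exists k; rewrite ?e.
    congr (M _ * _); apply/fsetP=> v; rewrite !inE.
    by case: (v \in R1); case: (v == t); case: (v == u); rewrite ?andbF ?andbT.
  apply: eq_bigr => V /andP[_ nt]; rewrite -big_distrl /=; congr (_ * _).
  rewrite [RHS](@M_rec_seq _ t (enum_fset R1)) ?fset_uniq //.
    rewrite !inE tR1 andbT; apply: contra nt => /imfsetP[k /= kV ->].
    by apply/exists_inP; exists k.
  by move=> u; rewrite !inE => /andP[].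
Qed.

(** * Vandermonde products *)

(** The absolute difference, as one of the two truncated terms is 0. It makes [vdm] independent of
    the order of the list. *)
Definition dist (x y : nat) : nat := (x - y) + (y - x).

Definition cross (l1 l2 : seq nat) : nat :=
  \prod_(x <- l1) \prod_(y <- l2) dist x y.

Fixpoint vdm (l : seq nat) : nat :=
  if l is x :: l' then (\prod_(y <- l') dist x y) * vdm l' else 1.

Lemma distC x y : dist x y = dist y x. Proof. by rewrite /dist addnC. Qed.

Lemma crossC l1 l2 : cross l1 l2 = cross l2 l1.
Proof.
rewrite /cross exchange_big; apply: eq_bigr => y _; apply: eq_bigr => x _.
exact: distC.
Qed.

Lemma cross_catl l1 l2 l : cross (l1 ++ l2) l = cross l1 l * cross l2 l.
Proof. by rewrite /cross big_cat. Qed.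

Lemma cross_perm l1 l1' l2 l2' : perm_eq l1 l1' -> perm_eq l2 l2' ->
  cross l1 l2 = cross l1' l2'.
Proof.
move=> p1 p2; rewrite /cross (perm_big _ p1) /=; apply: eq_bigr => x _.
exact: perm_big.
Qed.

Lemma vdm_cat l1 l2 : vdm (l1 ++ l2) = vdm l1 * vdm l2 * cross l1 l2.
Proof.
elim: l1 => [|x l1 IH] /=; first by rewrite /cross big_nil muln1 mul1n.
rewrite IH big_cat /cross big_cons /= -!mulnA; congr (_ * _).
rewrite mulnCA; congr (_ * _); exact: mulnCA.
Qed.

Lemma vdm_perm l1 l2 : perm_eq l1 l2 -> vdm l1 = vdm l2.
Proof.
elim: l1 l2 => [|x l1 IH] l2 p; first by move: p; rewrite perm_sym => /perm_nilP ->.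
have xl2 : x \in l2 by rewrite -(perm_mem p) mem_head.
case/splitPr: xl2 p => a b p.
have {}p : perm_eq l1 (a ++ b).
  by rewrite -(perm_cons x) (perm_trans p) // -cat1s perm_catCA.
rewrite /= (perm_big _ p) /= (IH _ p) !vdm_cat big_cat /= (crossC a (_ :: _)).
rewrite /cross big_cons -/(cross b a) (crossC b a).
ring.
Qed.

Lemma vdm_map (f : nat -> nat) l :
  {in l &, forall x y, dist (f x) (f y) = dist x y} -> vdm (map f l) = vdm l.
Proof.
elim: l => //= x l IH fl; rewrite IH => [|y z yl zl]; last first.
  by apply: fl; rewrite inE ?yl ?zl orbT.
rewrite big_map; congr (_ * _); apply: eq_big_seq => y yl.
by apply: fl; rewrite inE ?eqxx ?yl ?orbT.
Qed.

Lemma cross_map (f : nat -> nat) l1 l2 :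
  (forall x y, x \in l1 -> y \in l2 -> dist (f x) (f y) = dist x y) ->
  cross (map f l1) (map f l2) = cross l1 l2.
Proof.
move=> fl; rewrite /cross big_map; apply: eq_big_seq => x xl1.
by rewrite big_map; apply: eq_big_seq => y yl2; apply: fl.
Qed.

(** * Determinants of binomial coefficients *)

Local Open Scope ring_scope.

Definition ffact_poly (n : nat) : {poly rat} :=
  \prod_(i <- iota 0 n) ('X - (i%:R)%:P).

Lemma ffact_polyE n (x : nat) : (ffact_poly n).[x%:R] = (x ^_ n)%:R.
Proof.
rewrite /ffact_poly; elim: n => [|n IH]; first by rewrite big_nil hornerC.
rewrite -addn1 iotaD big_cat big_seq1 hornerM IH hornerXsubC addn1.
rewrite ffactnSr natrM; have [xn|nx] := leqP n x; first by rewrite natrB.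
by rewrite ffact_small // !mul0r.
Qed.

(** Falling factorials are monic of degree [j], so this is a Vandermonde matrix up to a
    unitriangular change of basis. *)
Lemma det_ffact n (x : nat -> nat) :
  \det (\matrix_(i < n, j < n) ((x i) ^_ j)%:R) =
  \prod_(i < n) \prod_(j < n | (i < j)%N) ((x j)%:R - (x i)%:R) :> rat.
Proof.
pose a : 'rV[rat]_n := \row_i (x i)%:R.
pose B : 'M[rat]_n := \matrix_(j, k) (ffact_poly j)`_k.
have sz j : size (ffact_poly j) = j.+1.
  by rewrite /ffact_poly size_prod_XsubC size_iota.
have -> : \matrix_(i < n, j < n) ((x i) ^_ j)%:R = (B *m Vandermonde n a)^T.
  apply/matrixP=> i j; rewrite !mxE -ffact_polyE (@horner_coef_wide _ n) ?sz //.
  by apply: eq_bigr => k _; rewrite !mxE.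
rewrite det_tr det_mulmx det_Vandermonde det_trig; last first.
  by apply/is_trig_mxP => i j ij; rewrite mxE nth_default // sz.
rewrite big1 ?mul1r => [|i _]; last first.
  have := monic_prod_XsubC (iota 0 i) predT (fun i => i%:R : rat).
  by rewrite monicE /lead_coef -/(ffact_poly i) sz mxE => /eqP.
by apply: eq_bigr => i _; apply: eq_bigr => j _; rewrite !mxE.
Qed.

Lemma vdm_sorted (l : seq nat) : sorted ltn l ->
  (vdm l)%:R = \prod_(i < size l) \prod_(j < size l | (i < j)%N)
     ((nth 0 l j)%:R - (nth 0 l i)%:R) :> rat.
Proof.
elim: l => [|x l IH] sl; first by rewrite big_ord0.
rewrite /= natrM big_ord_recl; congr (_ * _).
  rewrite [RHS]big_mkcond [RHS]big_ord_recl /= mul1r (big_nth 0%N) big_mkord natr_prod.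
  apply: eq_bigr => i _; have := order_path_min ltn_trans sl.
  move=> /(all_nthP 0%N)/(_ _ (ltn_ord i)) /= lt.
  by rewrite /dist (eqP (ltnW lt)) add0n natrB // ltnW.
rewrite IH ?(path_sorted sl) //; apply: eq_bigr => i _.
by rewrite [RHS]big_mkcond big_ord_recl /= mul1r -big_mkcond.
Qed.

Definition bincol (j v : nat) : rat := 'C(v, j)%:R.

Lemma det_binomial (l : seq nat) : sorted ltn l ->
  \det (\matrix_(i < size l, j < size l) bincol j (nth 0%N l i))
    * (hyperfactorial (size l))%:R = (vdm l)%:R.
Proof.
move=> sl; rewrite vdm_sorted // -(det_ffact (size l) (nth 0%N l)).
have -> : (hyperfactorial (size l))%:R =
   \det (diag_mx (\row_(j < size l) (j`!)%:R : 'rV[rat]_(size l))).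
  by rewrite det_diag /hyperfactorial natr_prod; apply: eq_bigr => i _; rewrite mxE.
rewrite -det_mulmx; congr (\det _); apply/matrixP=> i j.
by rewrite mul_mx_diag !mxE /bincol -natrM bin_ffact.
Qed.

(** The preceding row is subtracted from each row. The column of the ['C(v, 0) = 1] becomes a unit
    vector, and expanding along it lowers the size by one. *)
Lemma det_binomial_diff n (x : nat -> nat) :
  \det (\matrix_(i < n.+1, j < n.+1) bincol j (x i)) =
  \det (\matrix_(i < n, j < n) (bincol j.+1 (x i.+1) - bincol j.+1 (x i))).
Proof.
set A := \matrix_(i, j) bincol j (x i).
pose L : 'M[rat]_n.+1 := \matrix_(i, j) ((i == j)%:R - (i == j.+1 :> nat)%:R).
have detL : \det L = 1.
  rewrite det_trig; last first.
    apply/is_trig_mxP=> i j ij; rewrite mxE.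
    have -> : (i == j) = false by apply/negP=> /eqP e; rewrite e ltnn in ij.
    have -> : (i == j.+1 :> nat) = false by lia.
    by rewrite subrr.
  rewrite big1 // => i _; rewrite mxE eqxx.
  have -> : (i == i.+1 :> nat) = false by lia.
  by rewrite subr0.
have LA i j : (L *m A) i j = bincol j (x i) - (if (i : nat) is i'.+1 then bincol j (x i') else 0).
  rewrite mxE (eq_bigr (fun k => (i == k)%:R * A k j - (i == k.+1 :> nat)%:R * A k j)).
    rewrite sumrB; congr (_ - _).
      rewrite (bigD1 i) //= eqxx mul1r big1 ?addr0 ?mxE // => k ki.
      by rewrite eq_sym (negbTE ki) mul0r.
    case: i => [[|i] lti] /=; first by rewrite big1 // => k _; rewrite mul0r.
    rewrite (bigD1 (Ordinal (ltnW lti))) //= eqxx mul1r big1 ?addr0 ?mxE // => k ki.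
    rewrite eqSS; case: eqP => [e|]; last by rewrite mul0r.
    by case/negP: ki; apply/eqP/val_inj.
  by move=> k _; rewrite !mxE mulrBl.
rewrite -[LHS]mul1r -detL -det_mulmx (expand_det_col _ ord0) big_ord_recl.
rewrite LA /= subr0 [X in _ + X]big1 => [|i _]; last first.
  by rewrite LA lift0 /bincol !bin0 subrr mul0r.
rewrite /bincol bin0 mul1r addr0 /cofactor /= expr0 mul1r.
by congr (\det _); apply/matrixP=> i j; rewrite 2!mxE LA !lift0 mxE.
Qed.

Local Open Scope nat_scope.

(** * Dented trapezoids *)

Lemma inside_up_triangle p q k (b : bool) i j :
  inside (up_triangle p q k) (b, (i, j)) =
  [&& p <= i, q <= j & i + j + (~~ b).+1 <= p + q + k].
Proof. by rewrite /inside /up_triangle; case: b => /=; lia. Qed.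

Lemma inside_down_triangle p q k (b : bool) i j :
  inside (down_triangle p q k) (b, (i, j)) =
  [&& i < p + k, j < q & p + q <= i + j + ~~ b].
Proof. by rewrite /inside /down_triangle; case: b => /=; lia. Qed.

Lemma in_remove (R : region) (D : pred utri) t :
  (t \in remove R D) = (t \in R) && ~~ D t.
Proof. by rewrite !inE. Qed.

(** With the up-pointing base row missing, each down-pointing triangle of that row inside the big
    triangle keeps only its upper neighbour. These forced lozenges use up the base row of a triangle
    one row higher and of side one less. *)
Lemma M_forced_triangle (R : region) p q k :
  (forall i, p <= i < p + k -> (true, (i, q)) \notin R) ->
  (forall t, inside (up_triangle p q k) t -> ~~ (t.1 && (t.2.2 == q)) -> t \in R) ->
  M R = M (remove R (inside (up_triangle p q k))).
Proof.
elim: k q R => [|k IHk] q R baseR triR.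
  congr M; apply/fsetP=> -[b [i j]]; rewrite in_remove inside_up_triangle.
  by case: (_ \in R) => //=; lia.
(* The first [r] forced lozenges of the row. *)
pose X r : pred utri := fun t => (p <= t.2.1 < p + r) &&
  (if t.1 then t.2.2 == q.+1 else t.2.2 == q).
have forced r : r <= k -> M R = M (remove R (X r)).
  elim: r => [|r IHr] rk.
    congr M; apply/fsetP=> -[b [i j]]; rewrite in_remove /X /=.
    by case: (_ \in R) => //=; lia.
  rewrite IHr 1?ltnW //.
  rewrite (@M_forced _ (false, (p + r, q)) (true, (p + r, q.+1))); last first.
  - move=> [b [i j]]; rewrite in_remove adjacentE => /andP[vR _] /andP[hb adj].
    move: hb vR => -> vR; suff [-> ->] : i = p + r /\ j = q.+1 by [].
    have := contraL (baseR i); rewrite /adj_updown in adj.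
    case: (eqVneq j q) vR => [->|ne] vR; last by move=> _; lia.
    by move=> /(_ vR); lia.
  - by rewrite adjacentE /adj_updown; lia.
  - rewrite in_remove triR /X ?inside_up_triangle /=; lia.
  - rewrite in_remove triR /X ?inside_up_triangle /=; lia.
  congr M; apply/fsetP=> -[b [i j]]; rewrite !inE /= /X /= !xpair_eqE.
  by case: (_ \in R); case: b => //=; lia.
rewrite (forced k) // (IHk q.+1); last first.
- move=> [b [i j]] ins nb; rewrite in_remove triR; last 2 first.
  + by move: ins; rewrite !inside_up_triangle; lia.
  + by move: ins nb; rewrite !inside_up_triangle /=; lia.
  + by move: ins nb; rewrite !inside_up_triangle /X /=; case: b; lia.
- by move=> i hi; rewrite in_remove /X /= eqxx hi andbF.
congr M; apply/fsetP=> -[b [i j]]; rewrite !in_remove !inside_up_triangle /X /=.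
have := contraL (baseR i).
case: b; last by move=> _; case: (_ \in R) => //=; lia.
have [->|ne] := eqVneq j q; first by case: (_ \in R) => //= /(_ isT); lia.
by move=> _; case: (_ \in R) => //=; lia.
Qed.

Definition base_dents (q : nat) (P : seq nat) : pred utri :=
  fun t => [&& t.1, t.2.2 == q & t.2.1 \in P].

(** A pair in [T] is the left end and the side of an up-pointing triangle standing on the line at
    level [q]. *)
Definition in_triangles (q : nat) (T : seq (nat * nat)) : pred utri :=
  fun t => has (fun pk => inside (up_triangle pk.1 q pk.2) t) T.

Definition dent_positions (T : seq (nat * nat)) : seq nat :=
  flatten [seq iota pk.1 pk.2 | pk <- T].

Definition tri_disjoint (x y : nat * nat) : bool :=
  (x.1 + x.2 <= y.1) || (y.1 + y.2 <= x.1).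

(** Trades triangular dents for the unit dents along their bases, which brings ferns within reach of
    a formula for unit dents. Disjointness keeps the remaining triangles intact while one is being
    filled. *)
Lemma M_forced_triangles (R : region) q T : pairwise tri_disjoint T ->
  (forall pk t, pk \in T -> inside (up_triangle pk.1 q pk.2) t -> t \in R) ->
  M (remove R (base_dents q (dent_positions T))) = M (remove R (in_triangles q T)).
Proof.
elim: T R => [|[p k] T IH] R /=.
  move=> _ _; congr M; apply/fsetP=> t; rewrite !in_remove /base_dents in_nil.
  by rewrite !andbF.
move=> /andP[/allP dis dT] TR.
pose R1 := remove R (base_dents q (iota p k)).
have -> : remove R (base_dents q (dent_positions ((p, k) :: T))) =
          remove R1 (base_dents q (dent_positions T)).
  apply/fsetP=> t; rewrite !in_remove /base_dents /dent_positions /= mem_cat.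
  by rewrite -andbA; congr (_ && _); case: t.1; case: (_ == q) => //=; rewrite negb_or.
rewrite IH //; last first.
  move=> [p' k'] [b [i j]] pkT ins; rewrite in_remove (TR (p', k')) ?inE ?pkT ?orbT //.
  have := dis _ pkT; move: ins; rewrite /tri_disjoint /base_dents inside_up_triangle /=.
  by rewrite mem_iota; case: b; lia.
rewrite (@M_forced_triangle _ p q k); last first.
- move=> [b [i j]] ins nb; rewrite !in_remove (TR (p, k)) ?inE ?eqxx //=.
  apply/andP; split.
    by rewrite /base_dents /=; move: nb; rewrite /=; case: (b); case: (j == q).
  apply/hasPn=> -[p' k'] /dis; move: ins; rewrite !inside_up_triangle.
  by rewrite /tri_disjoint /=; lia.
- by move=> i hi; rewrite !in_remove /base_dents /= eqxx mem_iota hi andbF.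
congr M; apply/fsetP=> -[b [i j]]; rewrite !in_remove /in_triangles /base_dents /=.
rewrite inside_up_triangle mem_iota negb_or -!andbA.
case: (_ \in R) => //=; case: (has _ T) => //=; first by rewrite !andbF.
by rewrite !andbT; case: b; lia.
Qed.

(** Has the form of the enumeration in [hexagon], which thus folds to [box _ 0 _]. *)
Definition box (w q k : nat) : seq utri :=
  [seq (up, v) | up <- [:: true; false],
                 v <- [seq (i, j) | i <- iota 0 w, j <- iota q k]].

Lemma mem_box w q k b i j :
  ((b, (i, j)) \in box w q k) = (i < w) && (q <= j < q + k).
Proof.
apply/allpairsP/idP.
  move=> [[b' v] /= [_ /allpairsP[[i' j'] /= [hi hj ->]] [_ -> ->]]].
  by move: hi hj; rewrite !mem_iota; lia.
move=> h; exists (b, (i, j)); split=> //=; first by case: (b).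
by apply/allpairsP; exists (i, j); split=> //=; rewrite mem_iota; lia.
Qed.

(** Trapezoid of height [n] standing on the line at level [q], with bottom side [n + m], top side
    [m] and left side on [i = 0]. *)
Definition trap (q n m : nat) : region :=
  [fset t in box (n + m) q n | t.2.1 + t.2.2 + ~~ t.1 < q + n + m]%fset.

Lemma mem_trap q n m b i j : ((b, (i, j)) \in trap q n m) =
  [&& q <= j, j < q + n & i + j + ~~ b < q + n + m].
Proof. by rewrite /trap in_fset inE /= mem_box; lia. Qed.

Lemma mem_hexagon N NE SE S SW NW b i j :
  ((b, (i, j)) \in hexagon N NE SE S SW NW) =
  [&& i < N + NE, j < SW + NW, SW <= i + j + ~~ b
    & i + j + (~~ b).+1 <= SW + S + SE].
Proof.
rewrite /hexagon in_fset inE /= -/(box _ 0 _) mem_box /inside /hexagon_pt.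
by case: b => /=; lia.
Qed.

(** * Tiling a trapezoid row by row *)

Local Open Scope ring_scope.

(** Rows are functions, so that one list of rows serves for every [n]. The value 0 for a wrong
    number of rows reflects that there are no tilings when the number of dents differs from the
    height. *)
Definition dets (n : nat) (l : seq (nat -> rat)) : rat :=
  if size l == n then \det (\matrix_(i < n, j < n) nth (fun=> 0) l i j) else 0.

Lemma eq_dets n l1 l2 (f g : nat -> rat) : (forall j, f j = g j) ->
  dets n (l1 ++ f :: l2) = dets n (l1 ++ g :: l2).
Proof.
move=> fg; rewrite /dets !size_cat /=; case: eqP => // _; congr (\det _).
apply/matrixP=> i j; rewrite !mxE !nth_cat; case: ltnP => // _.
by case: (_ - _)%N => /=.
Qed.

Lemma detsD n l1 l2 (f g h : nat -> rat) : (forall j, f j = g j + h j) ->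
  dets n (l1 ++ f :: l2) = dets n (l1 ++ g :: l2) + dets n (l1 ++ h :: l2).
Proof.
move=> fgh; rewrite /dets !size_cat /=; case: eqP => [sz|]; last by rewrite addr0.
have lt1 : (size l1 < n)%N by lia.
rewrite -[X in _ = X + _]mul1r -[X in _ = _ + X]mul1r.
apply: (@determinant_multilinear _ _ _ _ _ (Ordinal lt1)).
- by apply/rowP=> j; rewrite !mxE !mul1r !nth_cat /= ltnn subnn.
- apply/matrixP=> i j; rewrite !mxE !nth_cat; case: ltnP => // le.
  have := neq_lift (Ordinal lt1) i; rewrite -val_eqE /=.
  by case e: (_ - _)%N => [|?] //=; move: e le; rewrite /=; lia.
- apply/matrixP=> i j; rewrite !mxE !nth_cat; case: ltnP => // le.
  have := neq_lift (Ordinal lt1) i; rewrite -val_eqE /=.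
  by case e: (_ - _)%N => [|?] //=; move: e le; rewrite /=; lia.
Qed.

Definition binrow (v : nat) : nat -> rat := fun j => bincol j v.
(** For [v <= w], the sum of the [binrow u] over [v <= u < w], by the hockey-stick identity. *)
Definition diffrow (v w : nat) : nat -> rat :=
  fun j => bincol j.+1 w - bincol j.+1 v.

Lemma diffrow_step i p j : diffrow i p j = diffrow i.+1 p j + binrow i j.
Proof. by rewrite /diffrow /binrow /bincol binS natrD; ring. Qed.

Lemma diffrow1 i j : diffrow i i.+1 j = binrow i j.
Proof. by rewrite /diffrow /binrow /bincol binS natrD; ring. Qed.

(** The branching step: by multilinearity, for increasing [p :: P] the left side sums the
    determinants over all choices of one position in each interval between consecutive dents. *)
Lemma dets_pairmap n p P :
  dets n (pairmap diffrow p P) = dets n.+1 (map binrow (p :: P)).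
Proof.
rewrite /dets /= size_pairmap size_map eqSS; case: eqP => // sz.
rewrite [RHS](_ : _ = \det (\matrix_(i < n.+1, j < n.+1) bincol j (nth 0%N (p :: P) i))).
  rewrite det_binomial_diff; congr (\det _); apply/matrixP=> i j.
  by rewrite !mxE (nth_pairmap 0%N) ?sz.
congr (\det _); apply/matrixP=> i j; rewrite !mxE -map_cons.
by rewrite (nth_map 0%N) //= sz.
Qed.

Section Scan.
Variables (q n m : nat).
Implicit Types (P V : seq nat).

(* The trapezoid after its bottom row has been tiled from the left: the up
   triangles before [i] and the down triangles before [i'] of that row are
   gone, as are the triangles of the next row standing on the positions in [V];
   [P] lists the dents. *)
Definition scanned (i i' : nat) V P : pred utri :=
  fun t => if t.2.2 == q then (if t.1 then (t.2.1 < i)%N || (t.2.1 \in P)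
                               else (t.2.1 < i')%N)
           else [&& t.1, t.2.2 == q.+1 & t.2.1 \in V].

Definition scan (i i' : nat) V P : region :=
  remove (trap q n.+1 m) (scanned i i' V P).

Lemma mem_scan i i' V P b k j : ((b, (k, j)) \in scan i i' V P) =
  [&& (q <= j)%N, (j < q + n.+1)%N, (k + j + ~~ b < q + n.+1 + m)%N
    & ~~ (if j == q then (if b then (k < i)%N || (k \in P) else (k < i')%N)
          else [&& b, j == q.+1 & k \in V])].
Proof. by rewrite /scan in_remove mem_trap /scanned -!andbA. Qed.

(** The left neighbour is used and nothing lies below, so the up-pointing triangle at [i] goes with
    the right one. *)
Lemma scan_fill i V P : i \notin P -> (i < n + m)%N ->
  M (scan i i V P) = M (scan i.+1 i.+1 V P).
Proof.
move=> iP im; rewrite (@M_forced _ (true, (i, q)) (false, (i, q))).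
- congr M; apply/fsetP=> -[b [k j]]; rewrite !in_fsetD1 !mem_scan !xpair_eqE /=.
  have [->|ne] := eqVneq j q; last by rewrite !andbF.
  by case: b => /=; lia.
- by rewrite mem_scan eqxx negb_or iP; lia.
- by rewrite mem_scan eqxx; lia.
- by rewrite adjacentE /adj_updown !eqxx.
move=> [b [k j]]; rewrite mem_scan adjacentE /adj_updown.
case: b => //= h1 h2; suff [-> ->] : k = i /\ j = q by [].
by move: h1 h2; case: eqP; lia.
Qed.

Lemma scan_stuck i V P : i \notin P -> i = (n + m)%N -> M (scan i i V P) = 0%N.
Proof.
move=> iP im; apply: (@M_isolated _ (true, (i, q))).
  by rewrite mem_scan eqxx negb_or iP; lia.
move=> [b [k j]]; rewrite mem_scan adjacentE /adj_updown.
by case: b => //=; case: eqP; lia.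
Qed.

Lemma scan_dent i V P : scan i i V (i :: P) = scan i.+1 i V P.
Proof.
apply/fsetP=> -[b [k j]]; rewrite !mem_scan inE.
by case: b; case: eqP => //=; case: (k \in P); lia.
Qed.

(** Having lost its left neighbour, the down-pointing triangle at [i] goes with the next up-pointing
    one of the row, or with the one above it. The latter makes [i] a dent of the next row, which
    exists only for nonzero [n]. *)
Lemma scan_pending i V P : (i < n + m)%N -> all (gtn i) V ->
  (M (scan i.+1 i V P) =
   (if i.+1 \in P then 0 else M (scan i.+2 i.+1 V P)) +
   (if n == 0 then 0 else M (scan i.+1 i.+1 (rcons V i) P)))%N.
Proof.
move=> im /allP Vi.
have iV : i \notin V by apply/negP=> /Vi /=; rewrite ltnn.
rewrite (@M_rec_seq _ (false, (i, q)) [:: (true, (i.+1, q)); (true, (i, q.+1))]).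
- rewrite !big_cons big_nil addn0 !mem_scan !adjacentE /adj_updown !eqxx /=.
  have -> : (q.+1 == q) = false by lia.
  rewrite !ltnn iV /= !orbT !andbT leqnn leqnSn /=.
  have -> : (q < q + n.+1)%N by lia.
  have -> : (i.+1 + q + 0 < q + n.+1 + m)%N by lia.
  have -> : (i + q.+1 + 0 < q + n.+1 + m)%N by lia.
  have -> : (q.+1 < q + n.+1)%N = (n != 0)%N by lia.
  rewrite /= !andbT; have [iP|iP] := boolP (i.+1 \in P).
    have [n0|n0] := eqVneq n 0%N => //=; rewrite add0n.
    congr M; apply/fsetP=> -[b [k j]]; rewrite !in_fsetD1 !mem_scan !xpair_eqE /=.
    rewrite mem_rcons inE.
    have [->|ne] := eqVneq j q; last by case: b => /=; case: (k \in V); lia.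
    by case: b => /=; case: (k \in P); lia.
  rewrite /=; congr (_ + _)%N.
    congr M; apply/fsetP=> -[b [k j]]; rewrite !in_fsetD1 !mem_scan !xpair_eqE /=.
    have [->|ne] := eqVneq j q; last by case: b => /=; case: (k \in V); lia.
    by case: b => /=; case: (k \in P); lia.
  have [n0|n0] := eqVneq n 0%N => //=.
  congr M; apply/fsetP=> -[b [k j]]; rewrite !in_fsetD1 !mem_scan !xpair_eqE /=.
  rewrite mem_rcons inE.
  have [->|ne] := eqVneq j q; last by case: b => /=; case: (k \in V); lia.
  by case: b => /=; case: (k \in P); lia.
- by rewrite mem_scan eqxx; lia.
- by rewrite /= inE !xpair_eqE; lia.
move=> [b [k j]]; rewrite mem_scan adjacentE /adj_updown !inE !xpair_eqE.
by case: b => //=; case: eqP => /=; lia.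
Qed.

Lemma scan_end V P : all (gtn (n + m)%N.+1) P ->
  scan (n + m).+1 (n + m) V P = remove (trap q.+1 n m) (base_dents q.+1 V).
Proof.
move=> /allP Pm; apply/fsetP=> -[b [k j]].
rewrite mem_scan in_remove mem_trap /base_dents /=.
have [->|ne] := eqVneq j q; first by case: b => /=; lia.
by case: b => /=; lia.
Qed.

Hypothesis IH : forall V, sorted ltn V -> all (gtn (n + m)%N) V ->
  (0 < n)%N || (V == [::]) ->
  (M (remove (trap q.+1 n m) (base_dents q.+1 V)))%:R = dets n (map binrow V).

(* Rows already decided contribute [binrow v]; a row still to be chosen in an
   interval contributes the sum of its [binrow]s, which telescopes to a
   [diffrow]. *)
Lemma scan_dets d i V P : (i + d = n + m)%N ->
  sorted ltn V -> all (gtn i) V -> (0 < n)%N || (V == [::]) -> sorted ltn P ->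
  all (gtn (n + m)%N.+1) P ->
  (all (ltn i) P ->
     (M (scan i.+1 i V P))%:R = dets n (map binrow V ++ pairmap diffrow i P)) /\
  (all (leq i) P ->
     (M (scan i i V P))%:R =
     if P is p :: P' then dets n (map binrow V ++ pairmap diffrow p P') else 0).
Proof.
elim: d i V P => [|d IHd] i V P iE sV Vi nV sP Pb.
  have pend P' : all (gtn (n + m)%N.+1) P' -> all (ltn i) P' ->
     (M (scan i.+1 i V P'))%:R = dets n (map binrow V ++ pairmap diffrow i P').
    case: P' => [_ _|p P' /= /andP[h1 _] /andP[h2 _]]; last by exfalso; move: h1 h2 => /=; lia.
    rewrite addn0 in iE; have Vi' : all (gtn (n + m)%N) V by rewrite -iE.
    by rewrite iE scan_end // IH // cats0.
  split; first exact: pend.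
  case: P sP Pb => [|p P'] sP Pb iP.
    by rewrite scan_stuck // -iE addn0.
  have pE : p = i.
    by move: iP Pb => /= /andP[h1 _] /andP[h2 _]; move: h2 => /=; lia.
  have iP' : all (ltn i) P' by rewrite -pE; apply: order_path_min sP; apply: ltn_trans.
  rewrite pE scan_dent pend //.
  by case/andP: Pb.
have im : (i < n + m)%N by lia.
have pend P' : sorted ltn P' -> all (gtn (n + m)%N.+1) P' -> all (ltn i) P' ->
   (M (scan i.+1 i V P'))%:R = dets n (map binrow V ++ pairmap diffrow i P').
  move=> sP' P'b iP'; rewrite scan_pending // natrD.
  have Vi1 : all (gtn i.+1) V by apply: sub_all Vi => k /=; lia.
  (* After a vertical lozenge at [i] the row is forced up to the next dent, so this interval
     contributes no further position. *)
  have vert P'' : sorted ltn P'' -> all (gtn (n + m)%N.+1) P'' -> all (ltn i) P'' ->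
     (if n == 0%N then 0 else M (scan i.+1 i.+1 (rcons V i) P''))%:R =
     if P'' is p :: P0 then dets n (map binrow V ++ binrow i :: pairmap diffrow p P0)
     else 0 :> rat.
    move=> s1 s2 s3; have [n0|n0] := eqVneq n 0%N.
      case: P'' s1 s2 s3 => [|p P0] // _ _ _.
      by rewrite /dets size_cat /= n0 addnS.
    have [] // := IHd i.+1 (rcons V i) P'' _ _ _ _ s1 s2.
    - by rewrite addSn -addnS.
    - rewrite -cats1; case: (V) sV Vi => //= v V' sV Vi.
      by rewrite cat_path sV /= andbT; apply: (allP (Vi : all (gtn i) (v :: V')) _ (mem_last v V')).
    - rewrite all_rcons Vi1 /= andbT; exact: ltnSn.
    - by rewrite lt0n n0.
    - move=> _ -> //; case: P'' s1 s2 s3 => // p P0 _ _ _.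
      by rewrite map_rcons cat_rcons.
  have [] // := IHd i.+1 V P' _ sV Vi1 nV sP' P'b; first by rewrite addSn -addnS.
  move=> C1 _.
  rewrite vert //; case: P' sP' P'b iP' C1 => [|p P'] sP' P'b iP' C1.
    by rewrite in_nil addr0 C1.
  have ip : (i < p)%N by case/andP: iP'.
  have pP' : all (ltn p) P' by apply: order_path_min sP'; apply: ltn_trans.
  (* The next up-pointing triangle is a dent: only the vertical lozenge remains. *)
  have [pi|pi] := eqVneq p i.+1.
    rewrite inE pi eqxx /= add0r; apply/esym/eq_dets => j; exact: diffrow1.
  have -> : (i.+1 \in p :: P') = false.
    rewrite inE eq_sym (negbTE pi) /=; apply/negP=> /(allP pP') /=; clear -ip; lia.
  rewrite C1; last first.
    rewrite /= (_ : (i.+1 < p)%N) /=; last by rewrite ltn_neqAle eq_sym pi.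
    by apply: sub_all pP' => k /=; apply: leq_trans.
  apply/esym/detsD => j; exact: diffrow_step.
split; first exact: pend.
move=> iP; case: P sP Pb iP => [|p P'] sP Pb iP.
  rewrite scan_fill //; have [] // := IHd i.+1 V [::] _ sV _ nV; first by lia.
    by apply: sub_all Vi => k /=; lia.
  by move=> _ ->.
have pP' : all (ltn p) P' by apply: order_path_min sP; apply: ltn_trans.
have [pi|pi] := eqVneq p i.
  rewrite pi scan_dent pend -?pi //.
    by rewrite (path_sorted sP).
  by case/andP: Pb.
have ip : (i < p)%N by case/andP: iP => /=; lia.
rewrite scan_fill //; last first.
  rewrite inE eq_sym (negbTE pi) /=; apply/negP=> /(allP pP') /=; clear -ip; lia.
have [] // := IHd i.+1 V (p :: P') _ sV _ nV sP Pb; first by lia.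
  by apply: sub_all Vi => k /=; lia.
move=> _ -> //=; rewrite ip /=.
by apply: sub_all pP' => k /=; lia.
Qed.
End Scan.

(** Induction on the height: scanning starts with nothing decided, and [dets_pairmap] absorbs the
    sum over the dents of the next row. The last hypothesis excludes dents on an empty trapezoid,
    where [remove] would ignore them. *)
Lemma M_trap_dets q n m P : sorted ltn P -> all (gtn (n + m)%N) P ->
  (0 < n)%N || (P == [::]) ->
  (M (remove (trap q n m) (base_dents q P)))%:R = dets n (map binrow P).
Proof.
elim: n q P => [|n IHn] q P sP Pb nP.
  rewrite (eqP nP) (_ : remove _ _ = fset0) ?M_fset0 /dets ?det_mx00 //.
  by apply/fsetP=> -[b [i j]]; rewrite in_remove mem_trap inE; lia.
have -> : remove (trap q n.+1 m) (base_dents q P) = scan q n m 0 0 [::] P.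
  apply/fsetP=> -[b [i j]]; rewrite mem_scan in_remove mem_trap /base_dents /=.
  by rewrite -!andbA; case: b; case: eqP => //=; rewrite ?andbF ?andbT.
have [] // := scan_dets (IHn q.+1) (add0n (n + m)) (V := [::]) _ _ _ sP Pb.
  by rewrite orbT.
move=> _ ->; last by apply/allP.
case: P sP Pb nP => [|p P'] sP Pb nP; last by rewrite /= dets_pairmap.
by rewrite /dets.
Qed.

(* The theorem of Cohn, Larsen and Propp. *)
Theorem M_trap_dents q n m P : uniq P -> all (gtn (n + m)%N) P ->
  (0 < n)%N || (P == [::]) ->
  (M (remove (trap q n m) (base_dents q P)) * hyperfactorial n)%N =
  if size P == n then vdm P else 0%N.
Proof.
move=> uP Pb nP; pose P' := sort leq P.
have pP : perm_eq P' P by rewrite perm_sort.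
have -> : remove (trap q n m) (base_dents q P) =
          remove (trap q n m) (base_dents q P').
  by apply/fsetP=> t; rewrite !in_remove /base_dents (perm_mem pP).
have sP' : sorted ltn P'.
  by rewrite ltn_sorted_uniq_leq (perm_uniq pP) uP sort_sorted //; apply: leq_total.
apply/eqP; rewrite -(eqr_nat rat) natrM M_trap_dets //; last 2 first.
- by rewrite (perm_all _ pP).
- by move: nP; rewrite -!size_eq0 (perm_size pP).
rewrite /dets size_map (perm_size pP); case: (size P =P n) => [sz|_]; last by rewrite mul0r.
rewrite -(vdm_perm pP) -(det_binomial sP') (perm_size pP) sz; apply/eqP.
congr (\det _ * _); apply/matrixP=> i j; rewrite !mxE (nth_map 0%N) //.
by rewrite (perm_size pP) sz.
Qed.

Local Open Scope nat_scope.

(** * Cutting along a horizontal line *)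

(* Otherwise [in_remove] tries to match every region by unfolding it. *)
#[local] Opaque remove trap.

Lemma in_triangles_base q T i :
  in_triangles q T (true, (i, q)) = (i \in dent_positions T).
Proof.
elim: T => // -[p k] T IH.
rewrite /in_triangles /dent_positions /= mem_cat -/(dent_positions T) -IH.
by congr (_ || _); rewrite inside_up_triangle mem_iota; lia.
Qed.

Lemma mem_dent_positions T i : (i \in dent_positions T) =
  has (fun pk => pk.1 <= i < pk.1 + pk.2) T.
Proof.
elim: T => // -[p k] T IH; rewrite /dent_positions /= mem_cat.
by rewrite -/(dent_positions T) IH mem_iota.
Qed.

Lemma mem_trap_base q n m i :
  ((true, (i, q)) \in trap q n m) = (0 < n) && (i < n + m).
Proof. by rewrite mem_trap; lia. Qed.

Definition tri_fit (n m : nat) (pk : nat * nat) : bool :=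
  (pk.1 + pk.2 <= n + m) && (pk.2 <= n).

Lemma M_trap_triangles q n m T S :
  pairwise tri_disjoint T -> all (tri_fit n m) T ->
  uniq (dent_positions T ++ S) -> all (gtn (n + m)) S ->
  (0 < n) || (dent_positions T ++ S == [::]) ->
  M (remove (remove (trap q n m) (base_dents q S)) (in_triangles q T))
    * hyperfactorial n
  = if size (dent_positions T) + size S == n
    then vdm (dent_positions T ++ S) else 0.
Proof.
move=> dT fT uTS Sb n0.
rewrite -M_forced_triangles //; last first.
  move=> [p k] [b [i j]] pkT ins; rewrite in_remove mem_trap /base_dents /=.
  have /andP[/= f1 f2] := allP fT _ pkT; move: ins; rewrite inside_up_triangle /=.
  move=> ins; apply/andP; split; first by move: ins; case: (b) => /=; lia.
  apply/negP=> /and3P[bT /eqP jq iS]; rewrite bT jq in ins.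
  move: uTS; rewrite cat_uniq => /and3P[_ /hasPn hS _]; have /negP[] := hS _ iS.
  by rewrite /= mem_dent_positions; apply/hasP; exists (p, k) => //=; lia.
rewrite -size_cat -(@M_trap_dents q n m); [|exact: uTS| |exact: n0]; last first.
  rewrite all_cat Sb andbT; apply/allP=> i; rewrite mem_dent_positions.
  by move=> /hasP[pk /(allP fT) /andP[]] /=; lia.
congr (_ * _); congr M; apply/fsetP=> t; rewrite 3!in_remove /base_dents mem_cat -andbA.
by congr (_ && _); case: t.1; case: (_ == _) => //=; rewrite negb_or andbC.
Qed.

Definition blocks (n h c : nat) : seq nat :=
  iota 0 n ++ iota (n + h) c ++ iota (n + h + c + h) n.

Lemma blocks_uniq n h c : uniq (blocks n h c).
Proof.
rewrite /blocks !cat_uniq !iota_uniq /= andbT; apply/andP; split.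
  by apply/hasPn=> i; rewrite mem_cat !mem_iota; lia.
by apply/hasPn=> i; rewrite !mem_iota; lia.
Qed.

(* Positions are counted from the right: the lower half is rotated by 180
   degrees, so that it becomes a trapezoid standing on its long side. *)
Definition gap_positions n w (V : {set 'I_w}) : seq nat :=
  [seq n + rev_ord k | k <- enum V].

(** [V] ranges over subsets of the whole window between the outer blocks, so that it is a set of
    ordinals; the second condition discards those meeting the middle block. No trace of the ferns is
    left, which makes the two regions comparable. *)
Definition gap_sum (n h c z : nat) : nat :=
  \sum_(V : {set 'I_(h + c + h)} |
     (#|V| == z) && all (fun p => p \notin blocks n h c) (gap_positions n V))
   vdm (gap_positions n V) ^ 2 * cross (blocks n h c) (gap_positions n V).

Lemma mirrorK a i : i < a -> a - (a - i.+1).+1 = i.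
Proof. by lia. Qed.

Lemma mirror_lt a i : i < a -> a - i.+1 < a.
Proof. by lia. Qed.

Section Line.
(** Above level [q] the region is a trapezoid of height [n1] with dents [T1]; below it is the image
    of a trapezoid of height [q] with dents [T2] under the half-turn [(i, j) -> (A - i, q - j)] of
    points. The window of crossings starts at [off], which is less than [n] when part of a block
    lies beyond the left end of the line. *)
Variables (n h c z off n1 m1 q m2 : nat) (T1 T2 : seq (nat * nat)) (R : region).
Let w := h + c + h.
Let A := off + n + w.
Let mirror i := A - i.+1.
Hypothesis upperR : forall b i j, q <= j -> ((b, (i, j)) \in R) =
  ((b, (i, j)) \in trap q n1 m1) && ~~ in_triangles q T1 (b, (i, j)).
Hypothesis lowerR : forall b i j, j < q -> ((b, (i, j)) \in R) =
  [&& i < A, (~~ b, (A - i.+1, q - j.+1)) \in trap 0 q m2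
    & ~~ in_triangles 0 T2 (~~ b, (A - i.+1, q - j.+1))].
Hypothesis lowerA : forall b i j, (b, (i, j)) \in trap 0 q m2 ->
  ~~ in_triangles 0 T2 (b, (i, j)) -> i < A.
Hypotheses (dT1 : pairwise tri_disjoint T1) (dT2 : pairwise tri_disjoint T2).
Hypotheses (fT1 : all (tri_fit n1 m1) T1) (fT2 : all (tri_fit q m2) T2).
Hypothesis blocksE : perm_eq (map mirror (dent_positions T1) ++ dent_positions T2)
                             (blocks n h c).
Hypotheses (off_le : off <= n) (w1 : off + w <= n1 + m1) (w2 : n + w <= q + m2).
Hypothesis A1 : n1 + m1 <= A.
Hypotheses (sz1 : size (dent_positions T1) + z = n1)
           (sz2 : size (dent_positions T2) + z = q).

Let R1 : region := [fset t in R | q <= t.2.2].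
Let R2 : region := [fset t in R | t.2.2 < q].
Let upk (k : 'I_w) : utri := (true, (off + k, q)).
Let dnk (k : 'I_w) : utri := (false, (off + k, q.-1)).
Let S1 (V : {set 'I_w}) : seq nat := [seq off + k | k <- map val (enum V)].
Let S2 (V : {set 'I_w}) : seq nat := gap_positions n V.

Let memR1 t : (t \in R1) = (q <= t.2.2) && (t \in R).
Proof. by rewrite !inE andbC. Qed.
Let memR2 t : (t \in R2) = (t.2.2 < q) && (t \in R).
Proof. by rewrite !inE andbC. Qed.

Let T1b i : i \in dent_positions T1 -> i < n1 + m1.
Proof.
by rewrite mem_dent_positions => /hasP[pk /(allP fT1) /andP[]]; lia.
Qed.

Let mirrorI : {in gtn A &, injective mirror}.
Proof. by move=> i j; rewrite !inE /mirror /=; lia. Qed.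

Let mem_mirror i : i < A ->
  (mirror i \in map mirror (dent_positions T1)) = (i \in dent_positions T1).
Proof.
move=> iA; apply/mapP/idP => [[j jT /mirrorI e]|iT]; last by exists i.
by rewrite e // inE /=; have := T1b jT; lia.
Qed.

Let notin_blocks i : i < A -> (mirror i \notin blocks n h c) =
  (i \notin dent_positions T1) && (mirror i \notin dent_positions T2).
Proof. by move=> iA; rewrite -(perm_mem blocksE) mem_cat negb_or mem_mirror. Qed.

Let upR i : ((true, (i, q)) \in R1) =
  [&& 0 < n1, i < n1 + m1 & i \notin dent_positions T1].
Proof.
by rewrite memR1 /= leqnn upperR // mem_trap_base in_triangles_base /= andbA.
Qed.

Let dnR i : ((false, (i, q.-1)) \in R2) =
  [&& 0 < q, i < A, mirror i < q + m2 & mirror i \notin dent_positions T2].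
Proof.
rewrite memR2 /=; have [q0|q0] := posnP q; first by rewrite q0.
rewrite lowerR prednK // leqnn /= subnn in_triangles_base mem_trap_base q0.
by rewrite -/(mirror i) /= andbA.
Qed.

(** A position free on both sides avoids the blocks. Left of the window it would be mirrored into
    the last block, right of it into the first one. *)
Let crossE t u : t \in R1 -> u \in R2 ->
  adjacent t u = [exists k, (t == upk k) && (u == dnk k)].
Proof.
move: t u => [b [i j]] [b' [i' j']] tR uR; have tR' := tR; have uR' := uR.
move: tR uR; rewrite memR1 memR2 /= => /andP[jq _] /andP[jq' _].
rewrite adjacentE; apply/idP/existsP => [|[k /andP[/eqP[-> -> ->] /eqP[-> -> ->]]]]; last first.
  by rewrite /adj_updown /=; lia.
case: b b' tR' uR' => [] [] //= tR uR; rewrite /adj_updown; last by lia.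
move=> adj; have [ei ej ej'] : [/\ i' = i, j = q & j' = q.-1].
  by clear -adj jq jq'; split; lia.
subst i' j j'; move: tR uR; rewrite upR dnR => /and3P[_ i1 iT1] /and4P[_ iA i2 iT2].
have : mirror i \notin blocks n h c by rewrite notin_blocks // iT1.
rewrite /blocks !mem_cat !mem_iota /mirror => nb.
have [oi kw] : off <= i /\ i - off < w.
  by move: nb iA off_le; rewrite /A /w; clear; split; lia.
exists (Ordinal kw); rewrite /upk /dnk /= !xpair_eqE !eqxx /=.
by rewrite subnKC ?eqxx.
Qed.

Let kA (k : 'I_w) : off + k < A.
Proof. by rewrite /A -addnA ltn_add2l ltn_addl. Qed.

Let mirror_window (k : 'I_w) : mirror (off + k) = n + rev_ord k.
Proof. by rewrite /mirror /A /=; have := ltn_ord k; lia. Qed.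

Let S1U V : uniq (S1 V).
Proof.
have addI : injective (addn off) by move=> x y /addnI.
by rewrite (map_inj_uniq addI) (map_inj_uniq val_inj) enum_uniq.
Qed.

Let mirrorS V : map mirror (S1 V) = S2 V.
Proof.
rewrite /S1 /S2 /gap_positions -!map_comp; apply: eq_map => k.
exact: mirror_window.
Qed.

Let S1A V i : i \in S1 V -> i < off + w.
Proof.
by move=> /mapP[k0 /mapP[k _ ->] ->]; rewrite ltn_add2l; apply: ltn_ord.
Qed.

Let S2U V : uniq (S2 V).
Proof.
rewrite -mirrorS map_inj_in_uniq ?S1U // => i j /S1A iA /S1A jA.
by apply: mirrorI; rewrite inE /= /A; lia.
Qed.

Let dist_mirror i j : i < A -> j < A -> dist (mirror i) (mirror j) = dist i j.
Proof. by rewrite /mirror /dist; lia. Qed.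

Let T1U : uniq (dent_positions T1) && uniq (dent_positions T2).
Proof.
have := blocks_uniq n h c; rewrite -(perm_uniq blocksE) cat_uniq.
by move=> /and3P[/map_uniq -> _ ->].
Qed.

Let term_upper (V : {set 'I_w}) :
  (forall k, k \in V -> upk k \in R1) ->
  M (R1 `\` [fset upk k | k in V]) * hyperfactorial n1 =
  if #|V| == z then vdm (dent_positions T1 ++ S1 V) else 0.
Proof.
move=> Vup.
have -> : R1 `\` [fset upk k | k in V] =
    remove (remove (trap q n1 m1) (base_dents q (S1 V))) (in_triangles q T1).
  apply/fsetP=> -[b [i j]]; rewrite in_fsetD memR1 2!in_remove /=.
  have -> : ((b, (i, j)) \in [fset upk k | k in V]) = base_dents q (S1 V) (b, (i, j)).
    rewrite /base_dents /=; apply/imfsetP/and3P.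
      move=> [k /= kV [-> -> ->]]; split=> //; apply: map_f; apply: map_f.
      by rewrite mem_enum.
    move=> [-> /eqP -> /mapP[k0 /mapP[k + ->] ->]]; rewrite mem_enum => kV.
    by exists k.
  have [jq|jq] := leqP q j; last by rewrite andbF mem_trap leqNgt jq.
  rewrite upperR //=; set x := _ \in trap _ _ _; set y := base_dents _ _ _.
  by case: x; case: y => //=; rewrite ?andbF.
have VS i : i \in S1 V -> i \notin dent_positions T1.
  move=> /mapP[k0 /mapP[k + ->] ->]; rewrite mem_enum => /Vup.
  by rewrite upR => /and3P[].
rewrite M_trap_triangles //.
- by rewrite size_map size_map -cardE -[n1 in _ == n1]sz1 eqn_add2l.
- rewrite cat_uniq S1U andbT; have /andP[-> _] := T1U; apply/hasPn=> i.
  exact: VS.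
- by apply/allP=> i /S1A /=; lia.
have [->//|[k kV]] := set_0Vmem V.
  rewrite /S1 enum_set0 cats0 -size_eq0; move: sz1; case: (n1) => //= s0.
  by move/eqP: s0; rewrite addn_eq0 => /andP[].
by have := Vup k kV; rewrite upR => /andP[->].
Qed.

Let term_lower (V : {set 'I_w}) :
  (forall k, k \in V -> dnk k \in R2) ->
  M (R2 `\` [fset dnk k | k in V]) * hyperfactorial q =
  if #|V| == z then vdm (dent_positions T2 ++ S2 V) else 0.
Proof.
move=> Vdn.
have mS2 k : k \in V -> mirror (off + k) \in S2 V.
  move=> kV; rewrite -mirrorS; apply: map_f; apply: map_f; apply: map_f.
  by rewrite mem_enum.
pose f (t : utri) : utri := (~~ t.1, (A - t.2.1.+1, q - t.2.2.+1)).
have f_in t : t \in R2 -> t.2.1 < A /\ t.2.2 < q.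
  case: t => [b [i j]]; rewrite memR2 /= => /andP[jq].
  by rewrite lowerR // => /and3P[].
rewrite -(@M_imfset (R2 `\` [fset dnk k | k in V])
   (remove (remove (trap 0 q m2) (base_dents 0 (S2 V))) (in_triangles 0 T2)) f).
- have VS i : i \in S2 V -> (i < n + w) && (i \notin dent_positions T2).
    rewrite -mirrorS => /mapP[i' i'S ->].
    have := S1A i'S; move: i'S => /mapP[k0 /mapP[k + ->] ->]; rewrite mem_enum => /Vdn.
    by rewrite dnR => /and4P[_ _ _ ->]; rewrite /mirror /A; lia.
  rewrite M_trap_triangles //.
  + by rewrite size_map -cardE -[q in _ == q]sz2 eqn_add2l.
  + rewrite cat_uniq S2U andbT; have /andP[_ ->] := T1U; apply/hasPn=> i.
    by move=> /VS/andP[].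
  + by apply/allP=> i /VS/andP[] /=; lia.
  have [->//|[k kV]] := set_0Vmem V.
    rewrite /S2 /gap_positions enum_set0 cats0 -size_eq0; move: sz2; case: (q) => //= s0.
    by move/eqP: s0; rewrite addn_eq0 => /andP[].
  by have := Vdn k kV; rewrite dnR => /andP[->].
- move=> [b [i j]]; rewrite in_fsetD => /andP[nV tR]; have [/= iA jq] := f_in _ tR.
  move: tR; rewrite memR2 lowerR //= => /and4P[_ _ t1 t2].
  rewrite /f /= 2!in_remove t1 t2 andbT /=; apply: contra nV.
  rewrite /base_dents /= => /and3P[b0 j0 iS].
  have [k kV e] : exists2 k, k \in V & A - i.+1 = mirror (off + k).
    move: iS; rewrite -mirrorS => /mapP[i' /mapP[k0 /mapP[k + ->] ->] ->].
    by rewrite mem_enum => kV; exists k.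
  apply/imfsetP; exists k => //; rewrite /dnk; congr (_, (_, _)).
  + by move: b0; case: (b).
  + by apply: mirrorI e; rewrite inE //=; apply: kA.
  + by clear -j0 jq; lia.
- move=> [b [i j]]; rewrite 2!in_remove => /andP[/andP[t1 t2] t3].
  have iA := lowerA t1 t3; have := t1; rewrite mem_trap => /and3P[_ jq _].
  exists (~~ b, (A - i.+1, q - j.+1)); last first.
    by rewrite /f /= negbK !mirrorK.
  have lt1 : A - i.+1 < A by apply: mirror_lt.
  have lt2 : q - j.+1 < q by apply: mirror_lt.
  rewrite in_fsetD memR2 /= lowerR // negbK !mirrorK // t1 t3 lt1 lt2 !andbT.
  apply: contra t2 => /imfsetP[k /= kV [eb ei ej]].
  rewrite /base_dents /= -[b]negbK eb /=; apply/andP; split.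
    by clear -ej jq; lia.
  by rewrite (_ : i = mirror (off + k)) ?mS2 // /mirror -ei mirrorK.
- move=> [b [i j]] [b' [i' j']]; rewrite !in_fsetD => /andP[_ /f_in[/= a1 a2]].
  move=> /andP[_ /f_in[/= a3 a4]] [/negb_inj -> e1 e2].
  by congr (_, (_, _)); clear -a1 a2 a3 a4 e1 e2; lia.
move=> [b [i j]] [b' [i' j']]; rewrite !in_fsetD => /andP[_ /f_in[/= a1 a2]].
move=> /andP[_ /f_in[/= a3 a4]]; rewrite /f /= !adjacentE /adj_updown.
by clear -a1 a2 a3 a4; case: b; case: b' => //=; lia.
Qed.

Theorem M_line :
  M R * hyperfactorial n1 * hyperfactorial q =
  vdm (dent_positions T1) * vdm (dent_positions T2) * gap_sum n h c z.
Proof.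
have -> : R = R1 `|` R2.
  by apply/fsetP=> t; rewrite in_fsetU memR1 memR2; case: leqP; rewrite ?orbF.
have upI : injective upk by move=> k l [] /addnI /val_inj.
have dnI : injective dnk by move=> k l [] /addnI /val_inj.
have dis : [disjoint R1 & R2]%fset.
  by apply/fdisjointP=> t; rewrite memR1 memR2 => /andP[h1 _]; rewrite ltnNge h1.
rewrite (M_cut upI dnI dis crossE) !big_distrl /= /gap_sum big_distrr /=.
(* Sets of another size give the upper trapezoid a wrong number of dents and contribute 0. *)
rewrite [LHS](bigID (fun V : {set 'I_w} => #|V| == z)) /= addnC big1; last first.
  move=> V /andP[/forall_inP hV /negbTE nz]; rewrite -[LHS]mulnA mulnACA.
  by rewrite term_upper ?nz ?mul0n // => k /hV/andP[].
rewrite add0n; apply: eq_big => [V|V /andP[/forall_inP hV /eqP zV]].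
  rewrite andbC; have [zV|//] := eqVneq #|V| z; rewrite /=.
  rewrite /gap_positions all_map; apply/forall_inP/allP => hV k.
    rewrite mem_enum => kV; have /andP[] := hV k kV; rewrite upR dnR.
    move=> /and3P[_ _ h1] /and4P[_ h2 _ h3].
    have : mirror (off + k) \notin blocks n h c by rewrite notin_blocks ?h1.
    by rewrite mirror_window.
  move=> kV; have z0 : 0 < z by rewrite -zV card_gt0; apply/set0Pn; exists k.
  have := hV k; rewrite mem_enum => /(_ kV) /=; rewrite -[_ - _]/(val (rev_ord k)) -mirror_window.
  rewrite notin_blocks // => /andP[k1 k2]; rewrite upR dnR k1 k2 (kA k) !andbT mirror_window.
  by have := ltn_ord k; have := ltn_ord (rev_ord k); lia.
rewrite -[LHS]mulnA mulnACA term_upper ?term_lower ?zV ?eqxx => [|k /hV/andP[]//|k /hV/andP[]//].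
(* The cross terms of both halves merge through [blocksE] into one with [blocks n h c]. *)
rewrite !vdm_cat -(cross_perm blocksE (perm_refl _)) cross_catl -/(S2 V).
have -> : vdm (S1 V) = vdm (S2 V).
  rewrite -mirrorS vdm_map // => i j /S1A iA /S1A jA.
  by apply: dist_mirror; rewrite /A; lia.
have -> : cross (dent_positions T1) (S1 V) =
          cross (map mirror (dent_positions T1)) (S2 V).
  rewrite -mirrorS cross_map // => i j /T1b iA /S1A jA.
  by apply: dist_mirror; rewrite /A; lia.
by rewrite -mulnn; ring.
Qed.
End Line.

(** * Ferns *)

(** Lists only the up-pointing triangles of a fern starting with orientation [up]; its down-pointing
    ones are obtained from [~~ up]. *)
Fixpoint fern_tris (up : bool) (p : nat) (t : seq nat) : seq (nat * nat) :=
  if t is k :: t' then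
    (if up then [:: (p, k)] else [::]) ++ fern_tris (~~ up) (p + k) t'
  else [::].

Lemma exists_ordS n (P : pred nat) :
  [exists i : 'I_n.+1, P i] = P 0 || [exists i : 'I_n, P i.+1].
Proof.
apply/existsP/orP => [[[[|i] ltin] /= Pi]|[P0|/existsP[i Pi]]]; first by left.
- by right; apply/existsP; exists (Ordinal (ltin : i < n)).
- by exists ord0.
- by exists (lift ord0 i); rewrite lift0.
Qed.

Lemma exists_fern (up : bool) p t (f : nat -> nat -> bool) :
  [exists i : 'I_(size t), (up (+) odd i) && f (p + sumn (take i t)) (nth 0 t i)]
  = has (fun pk => f pk.1 pk.2) (fern_tris up p t).
Proof.
elim: t up p => [|k t IH] up p /=; first by apply/existsP=> -[[]].
rewrite (exists_ordS (size t) (fun i => (up (+) odd i) &&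
  f (p + sumn (take i (k :: t))) (nth 0 (k :: t) i))) /= addn0 addbF has_cat.
congr (_ || _); first by case: up; rewrite //= orbF.
rewrite -IH; apply: eq_existsb => i /=.
by rewrite addnA addbN addNb.
Qed.

Definition in_down_triangles (q : nat) (T : seq (nat * nat)) : pred utri :=
  fun t => has (fun pk => inside (down_triangle pk.1 q pk.2) t) T.

Lemma fernE up p q t u : fern up p q t u =
  in_triangles q (fern_tris up p t) u || in_down_triangles q (fern_tris (~~ up) p t) u.
Proof.
rewrite /in_triangles /in_down_triangles.
rewrite -(exists_fern up p t (fun p k => inside (up_triangle p q k) u)).
rewrite -(exists_fern (~~ up) p t (fun p k => inside (down_triangle p q k) u)).
apply/existsP/orP => [[i]|[]/existsP[i /andP[upi ins]]]; last 2 first.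
- by exists i; rewrite upi.
- by exists i; rewrite addNb in upi; rewrite (negbTE upi).
rewrite /=; case upi: (up (+) odd i) => ins; [left|right].
  by apply/existsP; exists i; rewrite upi.
by apply/existsP; exists i; rewrite addNb upi.
Qed.

Lemma dentsE t u : dents t u = in_triangles 0 (fern_tris true 0 t) u.
Proof.
rewrite /in_triangles -(exists_fern true 0 t (fun p k => inside (up_triangle p 0 k) u)).
by apply: eq_existsb => i; rewrite add0n.
Qed.

Lemma size_dent_positions T : size (dent_positions T) = sumn (unzip2 T).
Proof.
by elim: T => //= -[p k] T IH; rewrite /dent_positions /= size_cat size_iota -IH.
Qed.

Lemma sum_fern up p t :
  \sum_(i < size t | up (+) odd i) nth 0 t i = size (dent_positions (fern_tris up p t)).
Proof.
rewrite size_dent_positions; elim: t up p => [|k t IH] up p; first by rewrite big_ord0.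
rewrite big_mkcond big_ord_recl /= addbF /unzip2 map_cat sumn_cat; congr (_ + _).
  by case: up; rewrite /= ?addn0.
rewrite -/(unzip2 _) -IH [RHS]big_mkcond; apply: eq_bigr => i _.
by rewrite /bump ?leq0n ?add1n /= addbN addNb.
Qed.

Lemma osumE p t : osum t = size (dent_positions (fern_tris true p t)).
Proof. by rewrite -sum_fern. Qed.

Lemma esumE p t : esum t = size (dent_positions (fern_tris false p t)).
Proof. by rewrite -sum_fern. Qed.

Lemma dent_positions_cat T1 T2 :
  dent_positions (T1 ++ T2) = dent_positions T1 ++ dent_positions T2.
Proof. by rewrite /dent_positions map_cat flatten_cat. Qed.

Lemma in_triangles_cat q T1 T2 u :
  in_triangles q (T1 ++ T2) u = in_triangles q T1 u || in_triangles q T2 u.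
Proof. exact: has_cat. Qed.

Lemma fern_tris_cat up p t1 t2 : fern_tris up p (t1 ++ t2) =
  fern_tris up p t1 ++ fern_tris (up (+) odd (size t1)) (p + sumn t1) t2.
Proof.
elim: t1 up p => [|k t1 IH] up p /=; first by rewrite addn0 addbF.
by rewrite IH -!catA addnA addbN addNb.
Qed.

Lemma fern_tris_shift up p d t :
  fern_tris up (p + d) t = [seq (pk.1 + d, pk.2) | pk <- fern_tris up p t].
Proof.
elim: t up p => //= k t IH up p; rewrite map_cat -IH addnAC.
by case: up.
Qed.

Lemma fern_tris_bound up p t (pk : nat * nat) : pk \in fern_tris up p t ->
  p <= pk.1 /\ pk.1 + pk.2 <= p + sumn t.
Proof.
elim: t up p => //= k t IH up p; rewrite mem_cat => /orP[|/IH]; last by lia.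
by case: up => //; rewrite inE => /eqP -> /=; lia.
Qed.

Lemma fern_tris_disjoint up p t : pairwise tri_disjoint (fern_tris up p t).
Proof.
elim: t up p => //= k t IH up p; rewrite pairwise_cat IH andbT.
case: up => //=; rewrite ?andbT ?allrel0l // allrel1l.
by apply/allP=> pk /fern_tris_bound; rewrite /tri_disjoint /=; lia.
Qed.

Lemma tri_size_le T (pk : nat * nat) : pk \in T -> pk.2 <= size (dent_positions T).
Proof.
elim: T => // -[p k] T IH; rewrite inE size_dent_positions /= => /predU1P[->|/IH] /=.
  exact: leq_addr.
rewrite size_dent_positions; lia.
Qed.

Definition mirror_tri (a : nat) (pk : nat * nat) : nat * nat := (a - pk.1 - pk.2, pk.2).

(** Read backwards, a fern is its mirror image; it then starts with its last triangle, of
    orientation [up (+) ~~ odd (size t)]. *)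
Lemma fern_tris_rev up p q t :
  fern_tris (up (+) ~~ odd (size t)) q (rev t) =
  rev (map (mirror_tri (q + (p + sumn t))) (fern_tris up p t)).
Proof.
elim: t up p => [|k t IH] up p //=; rewrite negbK rev_cons -cats1 fern_tris_cat.
have := IH (~~ up) (p + k); rewrite addbN addNb negbK => ->.
rewrite map_cat rev_cat !addnA; congr (_ ++ _).
rewrite size_rev -addbA addbb addbF sumn_rev /mirror_tri; case: up => //=.
by rewrite /rev /=; congr [:: (_, _)]; lia.
Qed.

Lemma perm_dent_positions_rev T :
  perm_eq (dent_positions (rev T)) (dent_positions T).
Proof. by apply: perm_flatten; apply: perm_map; rewrite perm_rev. Qed.

Lemma perm_mirror_iota a p k : p + k <= a ->
  perm_eq (map (fun i => a - i.+1) (iota p k)) (iota (a - p - k) k).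
Proof.
move=> pk; apply: uniq_perm; rewrite ?iota_uniq //.
  rewrite map_inj_in_uniq ?iota_uniq // => i j; rewrite !mem_iota; lia.
move=> i; rewrite mem_iota; apply/mapP/idP => [[j]|h].
  by rewrite mem_iota => h ->; lia.
by exists (a - i.+1); rewrite ?mem_iota; lia.
Qed.

Lemma dent_positions_mirror a T : all (fun pk => pk.1 + pk.2 <= a) T ->
  perm_eq (dent_positions (map (mirror_tri a) T))
          (map (fun i => a - i.+1) (dent_positions T)).
Proof.
elim: T => //= -[p k] T IH /andP[/= pk hT].
rewrite /dent_positions /= map_cat; apply: perm_cat; last exact: IH.
by rewrite perm_sym; apply: perm_mirror_iota.
Qed.

(** The two orientations together fill the segment of the fern, so only its length survives in
    [blocks]. *)
Lemma fern_positions up p t :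
  perm_eq (dent_positions (fern_tris up p t) ++ dent_positions (fern_tris (~~ up) p t))
          (iota p (sumn t)).
Proof.
elim: t up p => //= k t IH up p; rewrite !dent_positions_cat iotaD.
have := IH (~~ up) (p + k) => /permP IHc; apply/permP=> f.
move: (IHc f); rewrite !count_cat => <-.
by clear; case: up; rewrite /dent_positions /= ?cats0; lia.
Qed.

(** The region of [s t] is the trapezoid of height [osum t] and top side [esum t]; this turns
    Vandermonde products of ferns back into tiling numbers. *)
Lemma s_vdm t :
  s t * hyperfactorial (osum t) = vdm (dent_positions (fern_tris true 0 t)).
Proof.
have sz := osumE 0 t; have sz' := esumE 0 t.
have sumt : sumn t = osum t + esum t.
  by rewrite sz sz' -size_cat (perm_size (fern_positions true 0 t)) size_iota.
rewrite /s /dented_semihexagon.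
have -> : remove (hexagon (esum t) (osum t) 0 (osum t + esum t) 0 (osum t)) (dents t) =
  remove (remove (trap 0 (osum t) (esum t)) (base_dents 0 [::]))
         (in_triangles 0 (fern_tris true 0 t)).
  apply/fsetP=> -[b [i j]]; rewrite 3!in_remove dentsE /base_dents in_nil !andbF andbT.
  by congr (_ && _); rewrite mem_hexagon mem_trap; clear; case: b => /=; lia.
have uT : uniq (dent_positions (fern_tris true 0 t) ++ [::]).
  have := iota_uniq 0 (sumn t); rewrite -(perm_uniq (fern_positions true 0 t)).
  by rewrite cats0 cat_uniq => /andP[].
rewrite M_trap_triangles //.
- by rewrite cats0 addn0 -sz eqxx.
- exact: fern_tris_disjoint.
- apply/allP=> pk pkT; rewrite /tri_fit; have [_] := fern_tris_bound pkT.
  by have := tri_size_le pkT; rewrite -sz add0n sumt => -> ->.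
by rewrite cats0 -size_eq0 -sz; case: (osum t).
Qed.

Lemma vdm_iota p k : vdm (iota p k) = hyperfactorial k.
Proof.
elim: k p => [|k IH] p; first by rewrite /hyperfactorial big_ord0.
rewrite /= IH /hyperfactorial big_ord_recr /= mulnC; congr (_ * _).
rewrite (_ : \prod_(y <- iota p.+1 k) dist p y = \prod_(y <- iota 1 k) y).
  by rewrite fact_prod /index_iota subSS subn0.
rewrite -[p.+1]addn1 iotaDl big_map.
by apply: eq_bigr => i _; rewrite /dist; lia.
Qed.

(** An interval of length [n + h + c] is split into three pieces: dividing its Vandermonde product
    by those of the left two and of the right two pieces counts the middle piece once too often. *)
Lemma cross_iota n h c :
  cross (iota 0 n) (iota (n + h) c) * hyperfactorial (n + h) * hyperfactorial (h + c)
  = hyperfactorial (n + h + c) * hyperfactorial h.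
Proof.
rewrite -(vdm_iota 0 (n + h + c)) -addnA -(vdm_iota n (h + c)) -(vdm_iota 0 (n + h)).
rewrite !iotaD /= !vdm_cat [cross (iota 0 n) (_ ++ _)]crossC cross_catl.
rewrite !vdm_iota [cross _ (iota 0 n)]crossC [cross (iota (n + h) c) _]crossC add0n.
ring.
Qed.

(** * The two regions *)

(** [n + n + z] has the parity of [z], hence of [x], so the core needs no half-unit shift. *)
Lemma core_vertexE x n z h : h + h = x + z ->
  core_vertex x (n + n + z) z = (n + h, n + z).
Proof.
move=> hxz; rewrite /core_vertex !oddD addbb /=.
have -> : odd x = odd z.
  by have := congr1 odd hxz; rewrite !oddD addbb; case: (odd x); case: (odd z).
rewrite eqxx /=; congr (_, _).
  by rewrite addnC -addnA (addnC z) -hxz -addnACA addnn doubleK.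
by rewrite -addnA -addnACA addnn doubleK.
Qed.

Lemma M_cored x n z h c : h + h = x + z ->
  M (cored_hexagon x (n + n + z) z c) * hyperfactorial (n + c + z)
    * hyperfactorial (n + z) =
  vdm (iota 0 n ++ iota (n + h) c) * hyperfactorial n * gap_sum n h c z.
Proof.
move=> hxz; rewrite /cored_hexagon (core_vertexE n hxz).
(* The base of the core is [n] rows below the west vertex and [n] rows above the east one, so each
   half lacks a corner of side [n]; above the line the core is the dent [(n + h, c)]. *)
rewrite (@M_line n h c z n (n + c + z) x (n + z) (x + c) [:: (0, n); (n + h, c)] [:: (0, n)]).
- by rewrite /dent_positions /= !cats0 vdm_iota.
- move=> b i j qj; rewrite in_remove mem_hexagon mem_trap /in_triangles /=.
  rewrite !inside_up_triangle /=; move: hxz qj; clear; case: b => /=; lia.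
- move=> b i j jq; rewrite in_remove mem_hexagon mem_trap /in_triangles /=.
  rewrite !inside_up_triangle /=; move: hxz jq; clear; case: b => /=; lia.
- move=> b i j; rewrite mem_trap /= => t1 _; move: hxz t1; clear; lia.
- by rewrite /= /tri_disjoint /=; lia.
- by [].
- by rewrite /= /tri_fit /=; lia.
- by rewrite /= /tri_fit /=; lia.
- apply/permP=> f; rewrite /dent_positions /= !cats0 map_cat !count_cat.
  rewrite (permP (@perm_mirror_iota _ 0 n _)); last by lia.
  rewrite (permP (@perm_mirror_iota _ (n + h) c _)); last by lia.
  rewrite /blocks ?count_cat.
  rewrite (_ : n + n + (h + c + h) - 0 - n = n + h + c + h); last by lia.
  rewrite (_ : n + n + (h + c + h) - (n + h) - c = n + h); last by lia.
  by rewrite /=; lia.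
- by [].
- by lia.
- by lia.
- by lia.
- by rewrite /dent_positions /= cats0 size_cat !size_iota.
- by rewrite /dent_positions /= cats0 !size_iota.
Qed.

Lemma in_down_mirror a q T b i j : all (fun pk => pk.1 + pk.2 <= a) T ->
  i < a -> j < q ->
  in_triangles 0 (map (mirror_tri a) T) (~~ b, (a - i.+1, q - j.+1)) =
  in_down_triangles q T (b, (i, j)).
Proof.
move=> + ia jq; elim: T => //= -[p k] T IH /andP[/= pk /IH].
rewrite /in_triangles /in_down_triangles /= => ->; congr (_ || _).
rewrite inside_up_triangle inside_down_triangle; clear -pk ia jq.
by case: b => /=; lia.
Qed.

Lemma pairwise_mirror a T : all (fun pk => pk.1 + pk.2 <= a) T ->
  pairwise tri_disjoint T -> pairwise tri_disjoint (map (mirror_tri a) T).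
Proof.
elim: T => //= -[p k] T IH /andP[/= pk hT] /andP[/allP dT pT].
rewrite IH // andbT; apply/allP=> _ /mapP[[p' k'] pkT ->].
have := dT _ pkT; have := allP hT _ pkT; rewrite /tri_disjoint /=; clear -pk; lia.
Qed.

Lemma vdm_mirror a T : all (fun pk => pk.1 + pk.2 <= a) T ->
  vdm (dent_positions (map (mirror_tri a) T)) = vdm (dent_positions T).
Proof.
move=> hT; rewrite (vdm_perm (dent_positions_mirror hT)) vdm_map // => i j.
rewrite !mem_dent_positions => /hasP[pk /(allP hT) h1 h2] /hasP[pk' /(allP hT) h3 h4].
by clear -h1 h2 h3 h4; rewrite /dist; lia.
Qed.

Lemma size_dent_rev up p q t : size (dent_positions
  (fern_tris (up (+) ~~ odd (size t)) q (rev t))) =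
  size (dent_positions (fern_tris up p t)).
Proof.
rewrite (fern_tris_rev up p) (perm_size (perm_dent_positions_rev _)).
rewrite !size_dent_positions; congr sumn; rewrite /unzip2 -map_comp.
exact: eq_map.
Qed.

Lemma in_triangles_low q T b i j : j < q -> in_triangles q T (b, (i, j)) = false.
Proof.
move=> jq; apply/hasP=> -[pk _]; rewrite inside_up_triangle; clear -jq; lia.
Qed.

Lemma in_down_triangles_high q T b i j : q <= j ->
  in_down_triangles q T (b, (i, j)) = false.
Proof.
move=> jq; apply/hasP=> -[pk _]; rewrite inside_down_triangle; clear -jq; lia.
Qed.

(** * The region with three ferns *)

Section Ferns.
Variables (sa sb sc : seq nat) (h : nat).
Hypotheses (hm : 0 < size sa) (hm2 : ~~ odd (size sa)).
Hypotheses (hn : 0 < size sb) (hn2 : ~~ odd (size sb)).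
Hypotheses (hk : 0 < size sc) (hk2 : ~~ odd (size sc)).
Let a := sumn sa.
Let b := sumn sb.
Let c := sumn sc.

(** [rev sb] has even length and ends with an up-pointing triangle, hence starts with a
    down-pointing one. *)
Definition up_tris : seq (nat * nat) :=
  fern_tris true 0 sa ++ fern_tris true (a + h) sc
    ++ fern_tris false (a + h + c + h) (rev sb).

Definition down_tris : seq (nat * nat) :=
  fern_tris false 0 sa ++ fern_tris false (a + h) sc
    ++ fern_tris true (a + h + c + h) (rev sb).

(** Above the line, gaps and down-pointing triangles are mere distances: the gaps [h] merge with
    [a_m], and with [c_k] and [b_n]. *)
Definition upper_seq : seq nat :=
  take (size sa).-1 sa ++ (last 0 sa + h) ::
  take (size sc).-1 sc ++ (last 0 sc + h + last 0 sb) :: behead (rev sb).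

(** Below the line [h + c_1] and [h] are distances, and [yl], [yr] are the corners completing the
    lower half to a trapezoid. *)
Definition lower_seq (yl yr : nat) : seq nat :=
  yl :: sa ++ (h + head 0 sc) :: behead sc ++ h :: rev sb ++ [:: yr].

Lemma sumn_upper_seq : sumn upper_seq = a + h + c + h + b.
Proof.
rewrite /upper_seq /a /b /c; case/lastP: (sa) hm => // sa' x _.
case/lastP: (sc) hk => // sc' z' _; case/lastP: (sb) hn => // sb' w _.
rewrite !size_rcons /= -!cats1 !take_size_cat // rev_cat /= !last_cat /=.
by rewrite !sumn_cat /= ?sumn_cat /= ?sumn_cat sumn_rev /=; lia.
Qed.

Lemma upper_seq_tris : fern_tris true 0 upper_seq = up_tris.
Proof.
rewrite /upper_seq /up_tris /a /b /c; move: hm2 hk2.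
case/lastP: (sa) hm => // sa' x _; case/lastP: (sc) hk => // sc' z' _.
case/lastP: (sb) hn => // sb' w _.
rewrite !size_rcons /= !negbK => oa oc.
rewrite -!cats1 !take_size_cat // rev_cat /= !last_cat /=.
rewrite !fern_tris_cat /= oa /= fern_tris_cat /= oc /= !cats0 !sumn_cat /= !addn0.
by congr (_ ++ (_ ++ _)); congr fern_tris; lia.
Qed.

Lemma lower_seq_tris yl yr : fern_tris true 0 (lower_seq yl yr) =
  (0, yl) :: [seq (pk.1 + yl, pk.2) | pk <- down_tris]
    ++ [:: (yl + (a + h + c + h + b), yr)].
Proof.
rewrite /lower_seq /down_tris /a /b /c; move: hm2 hn2 hk2; case: (sc) hk => // c0 sc' _ /=.
move=> /negbTE oa /negbTE ob /negPn oc.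
rewrite !map_cat -!fern_tris_shift !add0n fern_tris_cat /= oa /= -!catA.
congr (_ :: (_ ++ _)); rewrite fern_tris_cat /= oc /= fern_tris_cat /= size_rev ob /=.
congr (_ ++ (_ ++ _)); try by congr fern_tris; lia.
by rewrite sumn_rev; congr [:: (_, _)]; lia.
Qed.

Lemma sumn_lower_seq yl yr : sumn (lower_seq yl yr) = yl + (a + h + c + h + b) + yr.
Proof.
rewrite /lower_seq /a /b /c; case: (sc) hk => // c0 sc' _ /=.
by rewrite !sumn_cat /= ?sumn_cat /= ?sumn_cat sumn_rev /=; lia.
Qed.

Lemma size_up_tris : size (dent_positions up_tris) = osum sa + osum sb + osum sc.
Proof.
rewrite /up_tris !dent_positions_cat !size_cat -!osumE.
have := size_dent_rev true 0 (a + h + c + h) sb; rewrite hn2 /= -osumE => ->.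
by lia.
Qed.

Lemma size_down_tris : size (dent_positions down_tris) = esum sa + esum sb + esum sc.
Proof.
rewrite /down_tris !dent_positions_cat !size_cat -!esumE.
have := size_dent_rev false 0 (a + h + c + h) sb; rewrite hn2 /= -esumE => ->.
by lia.
Qed.

Lemma osum_upper_seq : osum upper_seq = osum sa + osum sb + osum sc.
Proof. by rewrite (osumE 0) upper_seq_tris size_up_tris. Qed.

Lemma osum_lower_seq yl yr :
  osum (lower_seq yl yr) = yl + yr + (esum sa + esum sb + esum sc).
Proof.
rewrite (osumE 0) lower_seq_tris -size_down_tris !size_dent_positions /unzip2 /=.
rewrite map_cat sumn_cat /= -map_comp.
have -> : map (snd \o (fun pk => (pk.1 + yl, pk.2))) down_tris = map snd down_tris.
  exact: eq_map.
by lia.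
Qed.

Lemma ferns_positions (f : pred nat) (m : nat -> nat) :
  count f (map m (dent_positions up_tris)) + count f (map m (dent_positions down_tris))
  = count f (map m (iota 0 a)) + count f (map m (iota (a + h) c))
    + count f (map m (iota (a + h + c + h) b)).
Proof.
have cnt up p t : count f (map m (dent_positions (fern_tris up p t)))
    + count f (map m (dent_positions (fern_tris (~~ up) p t)))
    = count f (map m (iota p (sumn t))).
  by rewrite -count_cat -map_cat; apply: permP; apply: perm_map; apply: fern_positions.
rewrite /up_tris /down_tris !dent_positions_cat !map_cat !count_cat.
rewrite -(cnt true 0) -(cnt true (a + h)) /b -(sumn_rev sb) -(cnt false).
by rewrite /=; lia.
Qed.

Lemma mem_Q_removed q u :
  [|| fern true 0 q sa u, fern true (a + h) q sc u
    | fern (odd (size sb)) (a + h + c + h) q (rev sb) u] =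
  in_triangles q up_tris u || in_down_triangles q down_tris u.
Proof.
rewrite !fernE (negbTE hn2) /up_tris /down_tris /in_triangles /in_down_triangles !has_cat.
rewrite /=; set b1 := has _ _; set b2 := has _ _; set b3 := has _ _.
set b4 := has _ _; set b5 := has _ _; set b6 := has _ _.
by clear; case: b1; case: b2; case: b3; case: b4; case: b5; case: b6.
Qed.

Lemma up_tris_bound : all (fun pk => pk.1 + pk.2 <= a + h + c + h + b) up_tris.
Proof.
apply/allP=> pk; rewrite -upper_seq_tris => /fern_tris_bound[_].
by rewrite add0n sumn_upper_seq.
Qed.

Lemma down_tris_bound : all (fun pk => pk.1 + pk.2 <= a + h + c + h + b) down_tris.
Proof.
apply/allP=> pk pkT; have pkl : (pk.1 + 0, pk.2) \in fern_tris true 0 (lower_seq 0 0).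
  rewrite lower_seq_tris inE mem_cat; apply/orP; right; apply/orP; left.
  by apply/mapP; exists pk.
have [_] := fern_tris_bound pkl; rewrite sumn_lower_seq /=; clear; lia.
Qed.

Lemma M_Q x y z : h + h = x + z ->
  let n := y + maxn a b in
  let yl := y + (b - a) in
  let yr := y + (a - b) in
  M (Qregion x y z sa sc sb)
    * hyperfactorial (osum sa + osum sb + osum sc + z)
    * hyperfactorial (yl + yr + (esum sa + esum sb + esum sc) + z) =
  vdm (dent_positions (fern_tris true 0 upper_seq))
    * vdm (dent_positions (fern_tris true 0 (lower_seq yl yr)))
    * gap_sum n h c z.
Proof.
move=> hxz n yl yr.
have h2 : (x + z)./2 = h by rewrite -hxz addnn doubleK.
set O := osum sa + osum sb + osum sc; set E := esum sa + esum sb + esum sc.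
have OE : O + E = a + b + c.
  rewrite /O /E -size_up_tris -size_down_tris -size_cat.
  have := ferns_positions predT id; rewrite !map_id !count_predT !size_iota size_cat.
  by lia.
pose q := yl + yr + E + z.
pose A := a + n + (h + c + h).
(* [lower_seq] is measured from the outer end of the west corner, [yl] units before the origin of
   the region; hence the shift of [A]. *)
pose T2 := map (mirror_tri (A + yl)) (fern_tris true 0 (lower_seq yl yr)).
have nE1 : n = yl + a by rewrite /n /yl; lia.
have nE2 : n = yr + b by rewrite /n /yr; lia.
have bnd : all (fun pk => pk.1 + pk.2 <= A + yl) (fern_tris true 0 (lower_seq yl yr)).
  apply/allP=> pk /fern_tris_bound[_]; rewrite sumn_lower_seq /A; clear -nE2; lia.
have dbnd : all (fun pk => pk.1 + pk.2 <= A) down_tris.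
  apply: sub_all down_tris_bound => pk; rewrite /A; clear -nE2; lia.
have T2E : T2 = (A, yl) :: map (mirror_tri A) down_tris ++ [:: (0, yr)].
  have e1 : A + yl - 0 - yl = A by lia.
  have e2 : A + yl - (yl + (a + h + c + h + b)) - yr = 0 by rewrite /A; clear -nE2; lia.
  rewrite /T2 lower_seq_tris map_cons map_cat -map_comp {1 3}/mirror_tri /= e1 e2.
  congr (_ :: _ ++ _); apply: eq_map => -[p k]; rewrite /mirror_tri /=.
  by rewrite subnDr.
have memQ t : (t \in Qregion x y z sa sc sb) =
  (t \in hexagon (x + E) (y + z + O + (a - b)) (y + z + E + (b - a))
          (x + O) (y + z + E + (a - b)) (y + z + O + (b - a))) &&
  ~~ (in_triangles q up_tris t || in_down_triangles q down_tris t).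
  rewrite /Qregion h2 in_remove mem_Q_removed.
  suff -> : y + z + (esum sa + esum sb + esum sc) + (sumn sb - sumn sa)
     + (y + (sumn sa - sumn sb)) = q by [].
  by rewrite /q /yl /yr /a /b /E; clear; lia.
have pT2 : pairwise tri_disjoint T2.
  by apply: pairwise_mirror => //; apply: fern_tris_disjoint.
have bT2 (pk : nat * nat) : pk \in T2 -> (pk.1 + pk.2 <= A + yl)%N.
  by move=> /mapP[pk' /(allP bnd) + ->]; rewrite /mirror_tri /=; clear; lia.
rewrite -(vdm_mirror bnd) -/T2 upper_seq_tris -/q; clearbody T2.
apply: (@M_line n h c z a (O + z) (x + E) q (x + O) up_tris T2); rewrite -/A.
- move=> b0 i j qj; rewrite memQ mem_hexagon mem_trap in_down_triangles_high //.
  rewrite orbF; congr (_ && _); move: qj OE hxz; rewrite /q /yl /yr; clear.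
  by case: b0 => /=; lia.
- move=> b0 i j jq; rewrite memQ mem_hexagon mem_trap (in_triangles_low _ b0 i jq) orFb.
  (* [A] is the coordinate of the southeast side of the hexagon. *)
  have [iA|iA] := ltnP i A; last first.
    suff -> : (i < x + E + (y + z + O + (a - b))) = false by [].
    by move: iA OE hxz; rewrite /A /n; clear; lia.
  rewrite T2E -cat1s !in_triangles_cat in_down_mirror //.
  (* The west corner would have [i < 0], so its image lies at positions from [A] on. *)
  have -> : in_triangles 0 [:: (A, yl)] (~~ b0, (A - i.+1, q - j.+1)) = false.
    by rewrite /in_triangles /= inside_up_triangle; move: iA; clear; lia.
  rewrite /= negb_or [RHS]andbA [RHS]andbAC; congr (_ && _).
  rewrite /in_triangles /= inside_up_triangle; move: jq iA OE hxz.
  by rewrite /A /n /q /yl /yr; clear; case: b0 => /=; lia.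
- move=> b0 i j; rewrite mem_trap T2E /in_triangles /= inside_up_triangle.
  by move=> t1 /norP[+ _]; move: t1 OE hxz; rewrite /A /q /n /yl /yr; clear; lia.
- by rewrite -upper_seq_tris; apply: fern_tris_disjoint.
- exact: pT2.
- apply/allP=> pk pkT; rewrite /tri_fit; have := allP up_tris_bound _ pkT.
  have := tri_size_le pkT; rewrite size_up_tris -/O; move: OE hxz; clear; lia.
- apply/allP=> pk pkT; rewrite /tri_fit; apply/andP; split.
    by have := bT2 _ pkT; move: OE hxz; rewrite /q /A /n /yl /yr; clear; lia.
  have := tri_size_le pkT; rewrite T2E -cat1s !dent_positions_cat !size_cat.
  rewrite (perm_size (dent_positions_mirror dbnd)) size_map size_down_tris.
  by rewrite /dent_positions /= ?cats0 ?size_iota /q -/E; clear; lia.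
- apply/permP=> f; have := ferns_positions f (fun i => A - i.+1).
  rewrite (permP (@perm_mirror_iota A 0 a _)); last by rewrite /A; clear; lia.
  rewrite (permP (@perm_mirror_iota A (a + h) c _)); last by rewrite /A; clear; lia.
  rewrite (permP (@perm_mirror_iota A (a + h + c + h) b _)); last first.
    by rewrite /A; clear -nE2; lia.
  have -> : A - 0 - a = n + h + c + h by rewrite /A; clear; lia.
  have -> : A - (a + h) - c = n + h by rewrite /A; clear; lia.
  have -> : A - (a + h + c + h) - b = yr by rewrite /A; clear -nE2; lia.
  have dp1 p k : dent_positions [:: (p, k)] = iota p k.
    by rewrite /dent_positions /= cats0.
  have dT2 : perm_eq (dent_positions T2)
      (iota A yl ++ map (fun i => A - i.+1) (dent_positions down_tris) ++ iota 0 yr).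
    rewrite T2E -cat1s (dent_positions_cat [:: _]) (dent_positions_cat (map _ _)).
    by rewrite !dp1 perm_cat2l perm_cat2r dent_positions_mirror.
  rewrite count_cat (permP dT2) 2!count_cat /blocks 2!count_cat.
  (* After the half-turn the first block is the east corner and the right fern, the last one the
     left fern and the west corner. *)
  have -> : iota 0 n = iota 0 yr ++ iota yr b by rewrite [in LHS]nE2 iotaD.
  have -> : iota (n + h + c + h) n = iota (n + h + c + h) a ++ iota A yl.
    rewrite [X in iota _ X]nE1 [yl + a]addnC iotaD; congr (_ ++ iota _ _).
    by rewrite /A; clear; lia.
  by rewrite 2!count_cat /=; clear; lia.
- by rewrite nE1; apply: leq_addl.
- by rewrite /= ; move: OE hxz; clear; lia.
- by move: OE hxz; rewrite /q /n /yl /yr; clear; lia.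
- by rewrite /A; move: OE hxz nE2; clear; lia.
- by rewrite size_up_tris.
rewrite T2E -cat1s !dent_positions_cat !size_cat.
rewrite (perm_size (dent_positions_mirror dbnd)) size_map size_down_tris.
by rewrite /dent_positions /= ?cats0 ?size_iota /q -/E; clear; lia.
Qed.
End Ferns.

(** * Assembling the formula *)

Lemma hyperfactorial_gt0 n : 0 < hyperfactorial n.
Proof. by rewrite /hyperfactorial; apply: prodn_gt0 => i; apply: fact_gt0. Qed.

Local Open Scope ring_scope.

Theorem theorem2p6 (x y z : nat) (sa sb sc : seq nat)
    (hxz : odd x = odd z)
    (hm : (0 < size sa)%N) (hm2 : ~~ odd (size sa))
    (hn : (0 < size sb)%N) (hn2 : ~~ odd (size sb))
    (hk : (0 < size sc)%N) (hk2 : ~~ odd (size sc)) :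
  let a := sumn sa in
  let b := sumn sb in
  let c := sumn sc in
  let oabc := (osum sa + osum sb + osum sc)%N in
  let eabc := (esum sa + esum sb + esum sc)%N in
  let h := ((x + z)./2)%N in
  let mu := maxn a b in
  let nu := minn a b in
  let d := `|a%:Z - b%:Z|%N in
  let H := fun n : nat => (hyperfactorial n)%:R : rat in
  (M (Qregion x y z sa sc sb))%:R =
    (M (cored_hexagon x (2 * y + z + 2 * mu) z c))%:R
    * (s (take (size sa).-1 sa ++ (last 0 sa + h) ::
          take (size sc).-1 sc ++ (last 0 sc + h + last 0 sb) ::
          behead (rev sb))%N)%:R
    * (s ((y + b - nu) :: sa ++ (h + head 0 sc) :: behead sc ++ h ::
          rev sb ++ [:: y + a - nu])%N)%:R
    * (H (c + h)%N / (H c * H h)) * (H (mu + y + h)%N / H (mu + c + y + h)%N)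
    * ((H (mu + y + z)%N * H (mu + c + y + z)%N)
       / (H (oabc + z)%N * H (d + eabc + 2 * y + z)%N))
    * ((H oabc * H (d + eabc + 2 * y)%N) / H (mu + y)%N ^+ 2).
Proof.
move=> a b c oabc eabc h mu nu d H.
have h2 : (h + h = x + z)%N.
  by rewrite addnn /h halfK oddD hxz addbb subn0.
have H0 k : H k != 0 by rewrite pnatr_eq0 -lt0n hyperfactorial_gt0.
pose n := (y + maxn a b)%N; pose yl := (y + (b - a))%N; pose yr := (y + (a - b))%N.
have -> : (y + b - nu = yl)%N by rewrite /nu /yl; lia.
have -> : (y + a - nu = yr)%N by rewrite /nu /yr; lia.
rewrite -/(upper_seq sa sb sc h) -/(lower_seq sa sb sc h yl yr).
have -> : (2 * y + z + 2 * mu = n + n + z)%N by rewrite /n /mu; lia.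
have -> : (mu + y + h = n + h)%N by rewrite /n /mu; lia.
have -> : (mu + c + y + h = n + h + c)%N by rewrite /n /mu; lia.
have -> : (mu + y + z = n + z)%N by rewrite /n /mu; lia.
have -> : (mu + c + y + z = n + c + z)%N by rewrite /n /mu; lia.
have -> : (mu + y = n)%N by rewrite /n /mu; lia.
(* One of the two truncated differences in [yl] and [yr] is 0 and the other is [d]. *)
have -> : (d + eabc + 2 * y + z = yl + yr + eabc + z)%N by rewrite /d /yl /yr; lia.
have -> : (d + eabc + 2 * y = yl + yr + eabc)%N by rewrite /d /yl /yr; lia.
have EQ := congr1 (fun k => k%:R : rat) (M_Q hm hm2 hn hn2 hk hk2 y h2).
have EC := congr1 (fun k => k%:R : rat) (@M_cored x n z h c h2).
have E1 := congr1 (fun k => k%:R : rat) (s_vdm (upper_seq sa sb sc h)).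
have E2 := congr1 (fun k => k%:R : rat) (s_vdm (lower_seq sa sb sc h yl yr)).
have EX := congr1 (fun k => k%:R : rat) (cross_iota n h c).
move: EQ EC E1 E2 EX.
rewrite /= osum_upper_seq // osum_lower_seq // vdm_cat !vdm_iota !natrM.
rewrite -/oabc -/eabc -/a -/b -/c -/n -/yl -/yr.
rewrite -!/(H _) [(h + c)%N]addnC.
set X := (cross _ _)%:R; set G := (gap_sum _ _ _ _)%:R.
set MQ := (M (Qregion _ _ _ _ _ _))%:R; set MC := (M (cored_hexagon _ _ _ _))%:R.
set s1 := (s (upper_seq _ _ _ _))%:R; set s2 := (s (lower_seq _ _ _ _ _ _))%:R.
set v1 := (vdm _)%:R; set v2 := (vdm _)%:R.
move=> EQ EC E1 E2 EX.
have XE : X = H (n + h + c)%N * H h / (H (n + h)%N * H (c + h)%N).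
  by rewrite -EX -[X * _ * _]mulrA mulfK // mulf_neq0.
have X0 : X != 0 by rewrite XE !(mulf_neq0, invr_neq0).
(* The common sum [G] is solved for from the cored hexagon; [X] is nonzero as a quotient of
   hyperfactorials. *)
have GE : G = MC * H (n + c + z)%N * H (n + z)%N / (H n * H c * X * H n).
  by rewrite EC [RHS]mulrC mulKf // !mulf_neq0.
have -> : MQ = v1 * v2 * G / (H (oabc + z)%N * H (yl + yr + eabc + z)%N).
  by rewrite -EQ -[MQ * _ * _]mulrA mulfK // mulf_neq0.
rewrite GE -E1 -E2 XE; field.
by rewrite !H0.
Qed.
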